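(* Let $d\ge 1$ and let $g=\frac{(d-1)(d-2)}{2}$. For every integer $d'\ge 0$ with $d'\equiv d \pmod 3$, $d'\le d$, let $q_{d'}$ be the homogeneous polynomial in $z=(z_1,z_2,z_3)$ described in the context (with $q_0:=1$), where the positive numbers $t_{d',1},\dots,t_{d',d'}$ are pairwise distinct, satisfy $t_{d',d'-i+1}=1/t_{d',i}$, and for every such $d'\ge 3$ the sets $\{t_{d',i}\}_i$ and $\{t_{d'-3,j}\}_j$ are disjoint. Define recursively $p_0:=1$, $p_1:=q_1$, $p_2:=q_2$ and, for $d'\ge 3$, $$p_{d'}(z)=q_{d'}(z)+b_{d'}\,z_1z_2z_3\,p_{d'-3}(z),\qquad b_{d'}>0,$$ so that $p_d=\sum_{k=0}^{[d/3]}c_k\,q_{d-3k}(z)\,(z_1z_2z_3)^k$ with $c_0=1$, $c_k=b_db_{d-3}\cdots b_{d-3k+3}$. Then for each $d'\ge 3$ there is a threshold $B_{d'}>0$, depending only on the numbers $t_{\cdot,\cdot}$ and on $b_{d'-3},b_{d'-6},\dots$, such that if $b_{d'}>B_{d'}$ for every $d'\equiv d\pmod 3$ with $3\le d'\le d$, then $F(C_{p_d})$ has exactly $g$ holes, and $F(C_{p_d})$ meets each edge of the triangle $\Delta_2$ in exactly $d$ points.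
   Context: $\mathbb{CP}^2$ has homogeneous coordinates $[z_1,z_2,z_3]$. $F:\mathbb{CP}^2\to\Delta_2=\{r\in\mathbb{R}^3_{\ge0}: r_1+r_2+r_3=1\}$ is the moment map of the Fubini–Study form, $F([z])=(|z_1|^2,|z_2|^2,|z_3|^2)/(|z_1|^2+|z_2|^2+|z_3|^2)$. For a homogeneous polynomial $p$, $C_p=\{p=0\}\subset\mathbb{CP}^2$. A ''hole'' of $F(C_p)$ is a connected component of $\Delta_2\setminus F(C_p)$ whose closure is disjoint from $\partial\Delta_2$. For $d'\ge1$ define the binary form $q_{d'}(z_1,z_2)=\prod_{i=1}^{d'}(z_1+t_{d',i}z_2)=\sum_{i=0}^{d'}\beta_i z_1^{d'-i}z_2^i$ (so $\beta_0=\beta_{d'}=1$ and $\beta_{d'-i}=\beta_i$), and define the ternary form $q_{d'}(z_1,z_2,z_3)=\sum_I a_I z^I$, summing over $I=(i_1,i_2,i_3)\in\mathbb{Z}^3_{\ge0}$, $|I|=d'$, lying on the boundary of the Newton triangle (some $i_j=0$), with $a_{(d'-i,i,0)}=a_{(0,d'-i,i)}=a_{(i,0,d'-i)}=\beta_i$; coefficients at interior lattice points are $0$. $q_0:=1$. *)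

(* Defs.v *)
From HB Require Import structures.
From mathcomp Require Import all_boot all_order all_algebra.
From mathcomp Require Import all_classical all_reals all_analysis.
From mathcomp.real_closed Require Import complex.
Set Implicit Arguments. Unset Strict Implicit. Unset Printing Implicit Defensive.
Import Order.TTheory GRing.Theory Num.Theory.
Import numFieldNormedType.Exports.
Local Open Scope classical_set_scope.
Local Open Scope ring_scope.
Local Open Scope complex_scope.

Section Defs.
Variable R : realType.
Local Notation C := R[i].

(* beta_i of the binary form q_n(z1,z2) = prod_{i=1}^n (z1 + t_{n,i} z2)
   = sum_i beta_i z1^(n-i) z2^i ; computed as the coefficient of X^i in
   prod_{i=1}^n (1 + t_{n,i} X). *)
Definition qbeta (t : nat -> nat -> R) (n k : nat) : R :=
  (\prod_(i < n) (t n i.+1 *: 'X + 1))`_k.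

Definition qcoef (t : nat -> nat -> R) (n i1 i2 i3 : nat) : R :=
  if i3 == 0%N then qbeta t n i2
  else if i1 == 0%N then qbeta t n i3
  else if i2 == 0%N then qbeta t n i1
  else 0.

(* q_n(z) = sum_{|I| = n} a_I z^I   (for n = 0 this is the constant 1) *)
Definition qform (t : nat -> nat -> R) (n : nat) (z1 z2 z3 : C) : C :=
  \sum_(i1 < n.+1) \sum_(i2 < n.+1 | (i1 + i2 <= n)%N)
     (qcoef t n i1 i2 (n - i1 - i2))%:C * z1 ^+ i1 * z2 ^+ i2 * z3 ^+ (n - i1 - i2).

Fixpoint pform (t : nat -> nat -> R) (b : nat -> R) (n : nat) (z1 z2 z3 : C) : C :=
  match n with
  | k.+3 => qform t n z1 z2 z3 + (b n)%:C * (z1 * z2 * z3) * pform t b k z1 z2 z3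
  | _ => qform t n z1 z2 z3
  end.

Definition sqnorm (z : C) : R := (complex.Re z) ^+ 2 + (complex.Im z) ^+ 2.

Definition moment (z1 z2 z3 : C) : R * R * R :=
  let s := sqnorm z1 + sqnorm z2 + sqnorm z3 in
  (sqnorm z1 / s, sqnorm z2 / s, sqnorm z3 / s).

Definition Fcurve (P : C -> C -> C -> C) : set (R * R * R) :=
  [set r | exists z1 z2 z3 : C, (z1, z2, z3) != (0, 0, 0) /\
            P z1 z2 z3 = 0 /\ r = moment z1 z2 z3].

Definition Delta2 : set (R * R * R) :=
  [set r | 0 <= r.1.1 /\ 0 <= r.1.2 /\ 0 <= r.2 /\ r.1.1 + r.1.2 + r.2 = 1].

Definition edge1 : set (R * R * R) := [set r | Delta2 r /\ r.1.1 = 0].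
Definition edge2 : set (R * R * R) := [set r | Delta2 r /\ r.1.2 = 0].
Definition edge3 : set (R * R * R) := [set r | Delta2 r /\ r.2 = 0].
Definition bdDelta2 : set (R * R * R) := edge1 `|` edge2 `|` edge3.

Definition holes (S : set (R * R * R)) : set (set (R * R * R)) :=
  [set H : set (R * R * R) | exists x : R * R * R, (Delta2 `\` S) x /\
     H = connected_component (Delta2 `\` S) x /\
     closure H `&` bdDelta2 = set0].

End Defs.

(* Main.v *)
(* A point x of the open triangle off F(C_p) has an order ord(x) in Z^3: its i-th
   coordinate is the number of roots in the unit disc of w |-> p(.., w z_i, ..),
   for any z in the fibre torus of x.  Counting roots through means of the
   logarithmic derivative over roots of unity shows that the order is locally
   constant, that its coordinates add up to deg p, and that the root count along
   w |-> (w^(k_i) z_i) is <k, ord(x)>.  Hence two points of equal order are joined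
   off F(C_p): on logarithmic segments no root can cross the unit circle.  If
   ord(x)_i = 0, one can let z_i tend to 0 and reach the i-th edge; conversely the
   order has a vanishing coordinate near each edge, because p > 0 at the positive
   points of an edge.  So holes are in bijection with the interior lattice points
   of the Newton triangle that occur as orders.  By induction they all occur: the
   boundary ones near the edges, where p restricts to a product of the distinct
   linear forms z_a + t z_b, and an interior one because, for b large,
   b z1 z2 z3 p_(d-3) dominates q_d on the torus over a point where p_(d-3) has
   the order lowered by (1,1,1). *)

Require Import Defs.
From HB Require Import structures.
From mathcomp Require Import all_boot all_order all_algebra all_solvable all_field.
From mathcomp Require Import all_classical all_reals all_analysis.
From mathcomp.real_closed Require Import complex.
From mathcomp Require Import ring lra zify.
Set Implicit Arguments. Unset Strict Implicit. Unset Printing Implicit Defensive.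
Import Order.TTheory GRing.Theory Num.Theory.
Import numFieldNormedType.Exports.
Local Open Scope classical_set_scope.
Local Open Scope ring_scope.
Local Open Scope card_scope.

(** * Counting roots in the unit disc *)

(** Restrictions to the curves [w -> (w^(k_i) z_i)] are polynomials only for natural weights [k],
    while the logarithmic direction between two points of equal order is an arbitrary real vector.
    Homogeneity helps: scaling the target makes the direction nonnegative; a base [q] close to 1 and
    rounding down give natural exponents, and the rounding error is absorbed by a ball on which the
    order is constant. Linearity of the root count in [k] is not visible at a single point of the
    torus: the logarithmic derivative is linear in [k], but the points where it is evaluated move
    with [k]. Summing over a finite subgroup of the torus removes this dependence, because
    translations permute the subgroup. The discrete means are only approximately integers, so these
    arguments carry an explicit error and end by comparing integers. The error must be controlled on
    the whole torus at once, which is why compactness is used to find a root-free annulus uniform in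
    the parameter. *)

Section RootCount.
Variable C : numClosedFieldType.
Implicit Types (f : {poly C}) (a w : C) (rs : seq C).

(** Roots with multiplicity. For [f = 0] the list carries no information, hence the [f != 0]
    hypotheses below. *)
Definition proots f : seq C := sval (closed_field_poly_normal f).

Lemma proots_prod f : f = lead_coef f *: \prod_(a <- proots f) ('X - a%:P).
Proof. exact: (svalP (closed_field_poly_normal f)). Qed.

Definition cnt f : nat := count (fun a => `|a| < 1) (proots f).

Lemma proots_perm c rs : c != 0 ->
  perm_eq (proots (c *: \prod_(a <- rs) ('X - a%:P))) rs.
Proof.
move=> c0; apply: prod_XsubC_eq; have := proots_prod (c *: \prod_(a <- rs) ('X - a%:P)).
have -> : lead_coef (c *: \prod_(a <- rs) ('X - a%:P)) = c.
  by rewrite lead_coefZ (monicP (monic_prod_XsubC _ _ _)) mulr1.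
by move/(scalerI c0)=> <-.
Qed.

Lemma cnt_prod c rs : c != 0 ->
  cnt (c *: \prod_(a <- rs) ('X - a%:P)) = count (fun a => `|a| < 1) rs.
Proof. by move=> c0; rewrite /cnt; apply/permP/proots_perm. Qed.

Lemma root_proots f a : f != 0 -> root f a = (a \in proots f).
Proof.
move=> f0; rewrite {1}(proots_prod f) rootZ ?lead_coef_eq0 //.
by rewrite root_prod_XsubC.
Qed.

Lemma size_proots f : f != 0 -> size (proots f) = (size f).-1.
Proof.
move=> f0; rewrite {2}(proots_prod f) size_scale ?lead_coef_eq0 //.
by rewrite size_prod_XsubC.
Qed.

Lemma cntZXn c n : c != 0 -> cnt (c *: 'X^n) = n.
Proof.
move=> c0; have -> : 'X^n = \prod_(a <- nseq n (0 : C)) ('X - a%:P).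
  by rewrite big_nseq subr0; elim: n => // n IH; rewrite exprS IH.
by rewrite cnt_prod // count_nseq normr0 ltr01 mul1n.
Qed.

Lemma cntZ c f : c != 0 -> f != 0 -> cnt (c *: f) = cnt f.
Proof.
move=> c0 f0; rewrite {1}(proots_prod f) scalerA cnt_prod //.
by rewrite mulf_neq0 ?lead_coef_eq0.
Qed.

Lemma cntM f g : f != 0 -> g != 0 -> cnt (f * g) = (cnt f + cnt g)%N.
Proof.
move=> f0 g0; rewrite {1}(proots_prod f) {1}(proots_prod g).
rewrite -scalerAl -scalerAr scalerA -big_cat cnt_prod ?count_cat //.
by rewrite mulf_neq0 ?lead_coef_eq0.
Qed.

Lemma cnt_eq0 f a : f != 0 -> cnt f = 0%N -> `|a| < 1 -> f.[a] != 0.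
Proof.
move=> f0 /eqP; rewrite -leqn0 leqNgt -has_count => /hasPn fa a1.
apply/negP=> fa0; have /fa : a \in proots f by rewrite -root_proots.
by rewrite a1.
Qed.

Lemma eq0_cnt f : f != 0 -> (forall a, `|a| < 1 -> f.[a] != 0) -> cnt f = 0%N.
Proof.
move=> f0 fa; apply/eqP; rewrite -leqn0 leqNgt -has_count; apply/hasPn => a.
by rewrite -root_proots //= => /eqP fa0; apply/negP=> /fa; rewrite fa0 eqxx.
Qed.

Lemma cnt_comp_scale f (r : C) : 0 < r -> f != 0 ->
  cnt (f \Po (r *: 'X)) = count (fun a => `|a| < r) (proots f).
Proof.
move=> r0 f0; have r0' : r != 0 by rewrite gt_eqF.
have -> : f \Po (r *: 'X) = (lead_coef f * r ^+ size (proots f)) *: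
    \prod_(a <- map (fun a => a / r) (proots f)) ('X - a%:P).
  rewrite {1}(proots_prod f) linearZ /= -scalerA; congr (_ *: _).
  rewrite big_map rmorph_prod /=; elim: (proots f) => [|a s IH].
    by rewrite !big_nil expr0 scale1r.
  rewrite !big_cons /= IH exprSr -scalerA -scalerAr; congr (_ *: _).
  rewrite scalerAl; congr (_ * _).
  rewrite comp_polyB comp_polyX comp_polyC scalerBr; congr (_ - _).
  by rewrite -mul_polyC -polyCM mulrC divfK.
rewrite cnt_prod ?mulf_neq0 ?lead_coef_eq0 ?expf_neq0 // count_map.
apply: eq_count => a /=.
by rewrite normrM normfV (gtr0_norm r0) ltr_pdivrMr // mul1r.
Qed.

(** The rescaled polynomial counts the roots of modulus below [r]; a root in the annulus would make
    that count strictly larger than [cnt f]. *)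
Lemma cnt_annulus f (r : C) : 1 <= r -> f != 0 -> cnt (f \Po (r *: 'X)) = cnt f ->
  forall a, 1 <= `|a| < r -> f.[a] != 0.
Proof.
move=> r1 f0; rewrite cnt_comp_scale ?(lt_le_trans ltr01) // /cnt => E a /andP[a1 ar].
apply/negP => fa0; have sa : a \in proots f by rewrite -root_proots.
suff : (count (fun a => (`|a| < 1)%R) (proots f) < count (fun a => (`|a| < r)%R) (proots f))%N.
  by rewrite E ltnn.
rewrite !(permP (perm_to_rem sa)) /= ar (le_gtF a1) add0n add1n ltnS.
by apply: sub_count => b /= b1; apply: lt_le_trans b1 r1.
Qed.

Lemma horner_log_deriv f w : f.[w] != 0 ->
  f^`().[w] / f.[w] = \sum_(a <- proots f) (w - a)^-1.
Proof.
move: (proots f) (lead_coef f) (proots_prod f) => rs c ->.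
rewrite derivZ !hornerZ mulf_eq0 negb_or => /andP[c0].
rewrite invfM mulrACA divff // mul1r.
elim: rs => [|a rs IH]; first by rewrite !big_nil -[1]/(1%:P) derivC horner0 mul0r.
rewrite !big_cons derivM hornerD !hornerM derivXsubC hornerC mul1r !hornerXsubC.
rewrite mulf_eq0 negb_or => /andP[wa wr]; rewrite -IH //.
by field; rewrite wa wr.
Qed.

Lemma sum_unity_root_expr N (y : C) : y ^+ N = 1 -> y != 1 -> \sum_(j < N) y ^+ j = 0.
Proof.
move=> yN y1; apply: (mulfI (x := y - 1)); first by rewrite subr_eq0.
by rewrite -subrX1 yN subrr mulr0.
Qed.

(** For [x = z ^+ j], [1 - a^N = x^N - a^N] is divisible by [x - a], with quotient a finite
    geometric sum; summing over [j] kills every power of [a / x] but the zeroth. Divided by [N], the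
    value tends to 1 for [|a| < 1] and to 0 for [|a| > 1], so it detects roots in the disc. *)
Lemma sum_prim_root_inv N (z a : C) : N.-primitive_root z -> a ^+ N != 1 ->
  \sum_(j < N) z ^+ j / (z ^+ j - a) = N%:R / (1 - a ^+ N).
Proof.
move=> zN aN; have N0 := prim_order_gt0 zN.
have zj j : (z ^+ j) ^+ N = 1 by rewrite -exprM mulnC exprM (prim_expr_order zN) expr1n.
have z0 j : z ^+ j != 0.
  by apply: contraTneq (oner_neq0 C) => E; rewrite -(zj j) E expr0n gtn_eqF // eqxx.
have za j : z ^+ j - a != 0.
  by apply: contraNneq aN => /eqP; rewrite subr_eq0 => /eqP <-; rewrite zj.
apply: (mulIf (x := 1 - a ^+ N)); first by rewrite subr_eq0 eq_sym.
rewrite divfK ?subr_eq0 1?eq_sym // mulr_suml.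
transitivity (\sum_(j < N) \sum_(m < N) a ^+ m * ((z ^+ j)^-1) ^+ m).
  apply: eq_bigr => j _; rewrite -(zj j) subrXX mulrA divfK // mulr_sumr.
  apply: eq_bigr => m _; apply: (mulfI (x := (z ^+ j) ^+ m)); first by rewrite expf_neq0.
  rewrite [RHS]mulrCA -exprMn divff // expr1n mulr1 !mulrA -exprSr -exprD addSn.
  by rewrite subnKC ?prednK ?zj ?mul1r // -ltnS prednK.
rewrite exchange_big /= -(big_mkord xpredT (fun m => \sum_(j < N) a ^+ m * (z ^+ j)^-1 ^+ m)).
rewrite big_ltn // big_nat [X in _ + X]big1 ?addr0.
  by under eq_bigr => j _ do rewrite !expr0 mulr1; rewrite sumr_const card_ord.
move=> m mN; rewrite -mulr_sumr.
under eq_bigr => j _ do rewrite -exprVn -exprM mulnC exprM.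
rewrite sum_unity_root_expr ?mulr0 //.
  by rewrite !exprVn -exprM mulnC exprM (prim_expr_order zN) expr1n invr1.
by case/andP: mN => m0 mN; rewrite exprVn invr_eq1 -(prim_order_dvd zN) gtnNdvd.
Qed.

Lemma norm_sum_seq_le (T : eqType) (s : seq T) (F : T -> C) (B : C) :
  (forall x, x \in s -> `|F x| <= B) -> `|\sum_(x <- s) F x| <= (size s)%:R * B.
Proof.
elim: s => [|x s IH] sB; first by rewrite big_nil normr0 mul0r.
rewrite big_cons -natr1 mulrDl mul1r addrC; apply: le_trans (ler_normD _ _) _.
by apply: lerD; [apply: IH => y ys; apply: sB; rewrite inE ys orbT | apply: sB; rewrite mem_head].
Qed.

(* The N-th roots of unity discretise the contour integral of f'/f. *)
Definition log_mean N (z : C) f : C :=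
  N%:R^-1 * \sum_(j < N) z ^+ j * f^`().[z ^+ j] / f.[z ^+ j].

Lemma log_meanE N z f : N.-primitive_root z -> (forall w, `|w| = 1 -> f.[w] != 0) ->
  log_mean N z f = \sum_(a <- proots f) (1 - a ^+ N)^-1.
Proof.
move=> zN fw; have N0 := prim_order_gt0 zN; rewrite /log_mean.
have f0 : f != 0 by apply: contraNneq (fw 1 (normr1 _)) => ->; rewrite horner0.
have z1 j : `|z ^+ j| = 1.
  rewrite normrX; suff -> : `|z| = 1 by rewrite expr1n.
  by apply/eqP; rewrite -(pexpr_eq1 N0) // -normrX (prim_expr_order zN) normr1.
under eq_bigr => j _ do rewrite -mulrA horner_log_deriv ?fw // mulr_sumr.
rewrite exchange_big mulr_sumr /= !big_seq; apply: eq_bigr => a af.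
rewrite sum_prim_root_inv //.
  by rewrite mulrA mulVf ?mul1r // pnatr_eq0 -lt0n.
apply/eqP => aN; have := fw a; rewrite -rootE root_proots // af => H; suff: ~~ true by []; apply: H.
by apply/eqP; rewrite -(pexpr_eq1 N0) // -normrX aN normr1.
Qed.

(** A root inside contributes the error [a^N / (1 - a^N)], a root outside [1 / (1 - a^N)]; without
    roots in the annulus both are at most [q^N / (1 - q^N)] in modulus. *)
Lemma log_mean_cnt N z f (q : C) : N.-primitive_root z -> 0 < q < 1 ->
  f != 0 -> (forall a, q < `|a| < q^-1 -> f.[a] != 0) ->
  `|log_mean N z f - (cnt f)%:R| <= (size f)%:R * (q ^+ N / (1 - q ^+ N)).
Proof.
move=> zN /andP[q0 q1] f0 fq; have N0 := prim_order_gt0 zN.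
have qN1 : q ^+ N < 1 by rewrite exprn_ilt1 ?ltW // -lt0n.
rewrite log_meanE //; last first.
  by move=> w w1; apply: fq; rewrite w1 q1 invf_gt1.
rewrite /cnt -sum1_count natr_sum [X in _ - X]big_mkcond /= -sumrB.
have s0 : (size (proots f) <= size f)%N by rewrite size_proots // leq_pred.
have C0 : 0 <= q ^+ N / (1 - q ^+ N).
  by rewrite divr_ge0 ?subr_ge0 ?ltW // exprn_gt0.
apply: (@le_trans _ _ ((size (proots f))%:R * (q ^+ N / (1 - q ^+ N)))); last first.
  by rewrite ler_wpM2r // ler_nat.
apply: norm_sum_seq_le => a; rewrite -root_proots // rootE => fa0.
have [a1|a1] := boolP (`|a| < 1).
  have aq : `|a| <= q.
    rewrite real_leNgt ?realE ?normr_ge0 ?(ltW q0) //; apply/negP => qa.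
    by have := fq a; rewrite qa (lt_trans a1) ?invf_gt1 // fa0; move/(_ isT).
  have aqN : `|a ^+ N| <= q ^+ N by rewrite normrX lerXn2r ?nnegrE ?normr_ge0 // ltW.
  have aN1 : `|a ^+ N| < 1 by apply: le_lt_trans qN1.
  have aN : 1 - a ^+ N != 0.
    by rewrite subr_eq0; apply: contraTneq aN1 => <-; rewrite normr1 ltxx.
  have -> : (1 - a ^+ N)^-1 - 1 = a ^+ N / (1 - a ^+ N) by field.
  rewrite normrM normfV ler_pM ?invr_ge0 ?normr_ge0 //.
  rewrite lef_pV2 ?posrE ?normr_gt0 ?subr_gt0 //.
  apply: le_trans (lerB_dist _ _); rewrite normr1 lerD2l lerN2 //.
rewrite subr0 normfV.
have a1' : 1 <= `|a| by rewrite real_leNgt ?realE ?normr_ge0 ?ler01.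
have aq : q^-1 <= `|a|.
  rewrite real_leNgt ?realE ?normr_ge0 ?invr_ge0 ?(ltW q0) //; apply/negP => qa.
  by have := fq a; rewrite qa (lt_le_trans q1) // fa0; move/(_ isT).
have qN0 : 0 < q ^+ N by rewrite exprn_gt0.
have aqN : (q ^+ N)^-1 <= `|a ^+ N|.
  by rewrite normrX -exprVn lerXn2r ?nnegrE ?normr_ge0 ?invr_ge0 // ltW.
have qq : q ^+ N / (1 - q ^+ N) = ((q ^+ N)^-1 - 1)^-1.
  have -> : (q ^+ N)^-1 - 1 = (1 - q ^+ N) / q ^+ N by field; rewrite gt_eqF.
  by rewrite invf_div.
have p0 : 0 < (q ^+ N)^-1 - 1 by rewrite subr_gt0 invf_gt1.
rewrite qq lef_pV2 ?posrE //.
  rewrite distrC; apply: le_trans (lerB_dist _ _); rewrite normr1 ?lerD2r //.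
rewrite normr_gt0 subr_eq0; apply: contraTneq p0 => aN; apply/negP=> p0.
have : `|a ^+ N| < q ^- N by rewrite -aN normr1 -subr_gt0.
by rewrite (le_gtF aqN).
Qed.

Lemma exists_prim_root N : (0 < N)%N -> exists z : C, N.-primitive_root z.
Proof.
move=> N0; have XN1 : 'X^N - 1 \is @monic C by rewrite monicXnsubC.
have XN0 : 'X^N - 1 != 0 :> {poly C} by rewrite monic_neq0.
have Ers := proots_prod ('X^N - 1); rewrite (monicP XN1) scale1r in Ers.
have /hasP[z _ zN] : has N.-primitive_root (proots ('X^N - 1)); last by exists z.
apply: cyclic.has_prim_root => //.
- by apply/allP => a; rewrite -root_proots.
- by rewrite -separable_prod_XsubC -Ers separable_Xn_sub_1 // pnatr_eq0 -lt0n.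
- by rewrite size_proots // size_XnsubC.
Qed.

End RootCount.

(** * Squared moduli and polar coordinates *)

Section ComplexPlane.
Variable R : realType.
Local Notation C := R[i].
Implicit Types (z w : C).

Lemma sqnormM z w : sqnorm (z * w) = sqnorm z * sqnorm w.
Proof. by case: z w => [a b] [c e]; rewrite /sqnorm /=; ring. Qed.

Lemma sqnorm1 : sqnorm (1 : C) = 1.
Proof. by rewrite /sqnorm /= expr1n expr0n addr0. Qed.

Lemma sqnorm0 : sqnorm (0 : C) = 0.
Proof. by rewrite /sqnorm /= expr0n addr0. Qed.

Lemma sqnormX z n : sqnorm (z ^+ n) = sqnorm z ^+ n.
Proof. by elim: n => [|n IH]; rewrite ?expr0 ?sqnorm1 // !exprS sqnormM IH. Qed.

Lemma sqnorm_real (x : R) : sqnorm x%:C%C = x ^+ 2.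
Proof. by rewrite /sqnorm /= expr0n addr0. Qed.

Lemma sqnormN z : sqnorm (- z) = sqnorm z.
Proof. by case: z => a b; rewrite /sqnorm /= !sqrrN. Qed.

Lemma sqnorm_ge0 z : 0 <= sqnorm z.
Proof. by rewrite /sqnorm addr_ge0 ?sqr_ge0. Qed.

Lemma sqnormE z : (sqnorm z)%:C%C = `|z| ^+ 2.
Proof. exact: add_Re2_Im2. Qed.

Lemma sqnorm_eq0 z : (sqnorm z == 0) = (z == 0).
Proof.
by rewrite -(inj_eq (@complexI R)) sqnormE expf_eq0 normr_eq0.
Qed.

Lemma normr_sqnorm z : `|z| = (Num.sqrt (sqnorm z))%:C%C.
Proof. exact: normc_def. Qed.

Lemma normr_lt1 z : (`|z| < 1) = (sqnorm z < 1).
Proof. by rewrite -ltcR sqnormE expr_lt1. Qed.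

Lemma normr_eq1 z : (`|z| == 1) = (sqnorm z == 1).
Proof. by rewrite -(inj_eq (@complexI R)) sqnormE pexpr_eq1. Qed.

Lemma ler_Re_norm z (e : R) : `|z| <= e%:C%C -> `|complex.Re z| <= e.
Proof.
rewrite normr_sqnorm lecR => H; apply: le_trans H.
rewrite -sqrtr_sqr ler_sqrt ?sqnorm_ge0 //.
by rewrite /sqnorm lerDl sqr_ge0.
Qed.

Definition cis (x : R) : C := (cos x +i* sin x)%C.

Lemma sqnorm_cis x : sqnorm (cis x) = 1.
Proof. by rewrite /sqnorm /= cos2Dsin2. Qed.

Lemma unit_polar z : sqnorm z = 1 -> exists2 x : R, - pi <= x <= pi & z = cis x.
Proof.
case: z => a b; rewrite /sqnorm /= => ab.
have a1 : -1 <= a <= 1 by nra.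
have E : sin (acos a) = Num.sqrt (b ^+ 2).
  by rewrite sin_acos //; congr Num.sqrt; rewrite -ab addrC addKr.
have [p1 p2] : 0 <= acos a /\ acos a <= pi by rewrite acos_ge0 ?acos_lepi.
rewrite sqrtr_sqr in E; have [b0|b0] := leP 0 b.
  exists (acos a); first by rewrite p2 andbT; apply: le_trans p1; rewrite oppr_le0 pi_ge0.
  by rewrite /cis E acosK // ger0_norm.
exists (- acos a); first by rewrite lerN2 p2 /=; apply: (le_trans _ (pi_ge0 R)); rewrite oppr_le0.
by rewrite /cis cosN sinN E acosK // ltr0_norm // opprK.
Qed.

Lemma polar z : exists2 x : R, - pi <= x <= pi & z = (Num.sqrt (sqnorm z))%:C%C * cis x.
Proof.
have [->|z0] := eqVneq z 0.
  by exists 0; [rewrite oppr_le0 pi_ge0 | rewrite sqnorm0 sqrtr0 mul0r].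
have s0 : 0 < sqnorm z by rewrite lt0r sqnorm_eq0 z0 sqnorm_ge0.
have r0 : (Num.sqrt (sqnorm z))%:C%C != 0 by rewrite -sqnorm_eq0 sqnorm_real sqr_sqrtr ?ltW // gt_eqF.
have [|x xp E] := @unit_polar (z / (Num.sqrt (sqnorm z))%:C%C).
  apply: (mulIf (x := sqnorm z)); first by rewrite gt_eqF.
  by rewrite mul1r -{2}(sqr_sqrtr (ltW s0)) -sqnorm_real -sqnormM divfK.
by exists x => //; rewrite -E mulrC divfK.
Qed.

End ComplexPlane.

(** * Limits of complex-valued functions *)

Section Tends.
Variables (R : realType) (T : Type) (F : set_system T).
Context {FF : Filter F}.
Local Notation C := R[i].
Implicit Types (f g : T -> C) (z w : C).

(* Convergence in R[i] is handled through real and imaginary parts. *)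
Definition ctends f z :=
  (fun t => complex.Re (f t)) @ F --> complex.Re z /\
  (fun t => complex.Im (f t)) @ F --> complex.Im z.

Lemma ctends_cst z : ctends (fun=> z) z.
Proof. by split; exact: cvg_cst. Qed.

Lemma ctends_real (f : T -> R) (x : R) : f @ F --> x -> ctends (fun t => (f t)%:C%C) x%:C%C.
Proof. by move=> fx; split => //=; exact: cvg_cst. Qed.

Lemma ctends_cis (f : T -> R) (x : R) : f @ F --> x -> ctends (fun t => cis (f t)) (cis x).
Proof.
move=> fx; split => /=; apply: continuous_cvg => //; first exact: continuous_cos.
exact: continuous_sin.
Qed.

Lemma ctendsD f g z w : ctends f z -> ctends g w -> ctends (fun t => f t + g t) (z + w).
Proof.
move=> [fr fi] [gr gi]; split; rewrite raddfD; under eq_fun => t do rewrite raddfD.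
  exact: cvgD.
exact: cvgD.
Qed.

Lemma ctendsM f g z w : ctends f z -> ctends g w -> ctends (fun t => f t * g t) (z * w).
Proof.
move=> [fr fi] [gr gi]; have Re_M (a b : C) : complex.Re (a * b) =
  complex.Re a * complex.Re b - complex.Im a * complex.Im b by case: a b => [? ?] [].
have Im_M (a b : C) : complex.Im (a * b) =
  complex.Re a * complex.Im b + complex.Im a * complex.Re b by case: a b => [? ?] [].
split; rewrite ?Re_M ?Im_M.
  by under eq_fun => t do rewrite Re_M; apply: cvgB; apply: cvgM.
by under eq_fun => t do rewrite Im_M; apply: cvgD; apply: cvgM.
Qed.

Lemma ctends_sqnorm f z : ctends f z -> (fun t => sqnorm (f t)) @ F --> sqnorm z.
Proof. by move=> [fr fi]; apply: cvgD; rewrite /=; apply: cvgM. Qed.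

Lemma ctendsV f z : z != 0 -> ctends f z -> ctends (fun t => (f t)^-1) z^-1.
Proof.
move=> z0 fz; have /= := ctends_sqnorm fz; case: fz => fr fi fs.
have s0 : sqnorm z != 0 by rewrite sqnorm_eq0.
have ReV (a : C) : complex.Re a^-1 = complex.Re a / sqnorm a by case: a.
have ImV (a : C) : complex.Im a^-1 = - complex.Im a / sqnorm a.
  by case: a => a b; rewrite mulNr.
split; rewrite ?ReV ?ImV.
  by under eq_fun => t do rewrite ReV; apply: cvgM => //; apply: cvgV.
by under eq_fun => t do rewrite ImV; apply: cvgM; [apply: cvgN|apply: cvgV].
Qed.

Lemma ctendsX f z n : ctends f z -> ctends (fun t => f t ^+ n) (z ^+ n).
Proof.
move=> fz; elim: n => [|n IH].
  by under eq_fun do rewrite expr0; exact: ctends_cst.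
by under eq_fun do rewrite exprS; rewrite exprS; exact: ctendsM.
Qed.

Lemma ctends_sum (I : Type) (r : seq I) (f : I -> T -> C) (z : I -> C) :
  (forall i, ctends (f i) (z i)) -> ctends (fun t => \sum_(i <- r) f i t) (\sum_(i <- r) z i).
Proof.
move=> fz; elim: r => [|i r IH].
  by under eq_fun do rewrite big_nil; rewrite big_nil; exact: ctends_cst.
by under eq_fun do rewrite big_cons; rewrite big_cons; exact: ctendsD.
Qed.

Lemma ctends_prod (I : Type) (r : seq I) (f : I -> T -> C) (z : I -> C) :
  (forall i, ctends (f i) (z i)) -> ctends (fun t => \prod_(i <- r) f i t) (\prod_(i <- r) z i).
Proof.
move=> fz; elim: r => [|i r IH].
  by under eq_fun do rewrite big_nil; rewrite big_nil; exact: ctends_cst.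
by under eq_fun do rewrite big_cons; rewrite big_cons; exact: ctendsM.
Qed.

Lemma ctends_neq0 f z : z != 0 -> ctends f z -> \forall t \near F, f t != 0.
Proof.
move=> z0 /ctends_sqnorm fs; have s0 : 0 < sqnorm z by rewrite lt0r sqnorm_eq0 z0 sqnorm_ge0.
have H : \forall t \near F, 0 < sqnorm (f t) by exact: (cvgr_gt (sqnorm z)).
by apply: filterS H => t; apply: contraTneq => ->; rewrite sqnorm0 ltxx.
Qed.

End Tends.

(** * Homotopy invariance of the root count *)

Section Homotopy.
Variable R : realType.
Local Notation C := R[i].

Lemma ctends_horner (T : Type) (F : set_system T) {FF : Filter F} (f : T -> {poly C})
    (g : {poly C}) (m : nat) (u : T -> C) (w : C) :
  (forall t, (size (f t) <= m)%N) -> (size g <= m)%N ->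
  (forall i, ctends F (fun t => (f t)`_i) g`_i) -> ctends F u w ->
  ctends F (fun t => (f t).[u t]) g.[w].
Proof.
move=> fm gm fg uw; rewrite (horner_coef_wide _ gm).
under eq_fun => t do rewrite (horner_coef_wide _ (fm t)).
apply: ctends_sum => i; apply: ctendsM => //; exact: ctendsX.
Qed.

(** A tube lemma: convergence jointly in [t] and in the parameter makes non-vanishing uniform over
    the compact [K]. It is applied to annuli, to fibre tori, to discs at an edge, and to a
    dominating term. *)
Lemma near_compact_neq0 (T : topologicalType) (K : set T) (I : Type) (F : set_system I)
    {FF : Filter F} (f : T -> I -> C) (l : T -> C) :
  compact K ->
  (forall t, K t -> l t != 0 /\ ctends (filter_prod (nbhs t) F) (fun p => f p.1 p.2) (l t)) ->
  \forall i \near F, forall t, K t -> f t i != 0.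
Proof.
move=> /compact_near_coveringP cK fl.
apply: (cK I F (fun i t => f t i != 0) FF) => t Kt; have [l0 tl] := fl t Kt.
exact: ctends_neq0 l0 tl.
Qed.

Lemma root_gap (T : topologicalType) (K : set T) (f : T -> {poly C}) (m : nat) :
  compact K -> (forall t, (size (f t) <= m)%N) ->
  (forall t, K t -> forall i, ctends (nbhs t) (fun s => (f s)`_i) (f t)`_i) ->
  (forall t, K t -> forall w, sqnorm w = 1 -> (f t).[w] != 0) ->
  exists2 q : R, 0 < q < 1 &
    forall t, K t -> forall a : C, q%:C%C < `|a| < (q%:C%C)^-1 -> (f t).[a] != 0.
Proof.
move=> cK fm fc fw.
have cKI : compact (K `*` `[- pi, pi : R]) by apply: compact_setX => //; exact: segment_compact.
have : \forall r \near (1 : R), forall tx, (K `*` `[- pi, pi : R]) tx ->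
    (f tx.1).[r%:C%C * cis tx.2] != 0.
  have H : forall tx, (K `*` `[- pi, pi : R]) tx -> (f tx.1).[1%:C%C * cis tx.2] != 0 /\
      ctends (filter_prod (nbhs tx) (nbhs (1 : R)))
        (fun p => (f p.1.1).[p.2%:C%C * cis p.1.2]) (f tx.1).[1%:C%C * cis tx.2].
    move=> [t x] [/= Kt xpi]; split; first by rewrite mul1r fw ?sqnorm_cis.
    have c1 : fst @ filter_prod (nbhs (t, x)) (nbhs (1 : R)) --> (t, x) by exact: cvg_fst.
    have c2 : snd @ filter_prod (nbhs (t, x)) (nbhs (1 : R)) --> (1 : R) by exact: cvg_snd.
    have c11 : (fun p : T * R * R => p.1.1) @ filter_prod (nbhs (t, x)) (nbhs (1 : R)) --> t.
      exact: (cvg_comp _ _ c1 cvg_fst).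
    have c12 : (fun p : T * R * R => p.1.2) @ filter_prod (nbhs (t, x)) (nbhs (1 : R)) --> x.
      exact: (cvg_comp _ _ c1 cvg_snd).
    apply: (ctends_horner (m := m)) => //.
      move=> i; have [fr fi] := fc t Kt i.
      by split; [exact: (cvg_comp _ _ c11 fr)|exact: (cvg_comp _ _ c11 fi)].
    by apply: ctendsM; [exact: ctends_real|exact: ctends_cis].
  exact: (near_compact_neq0 (f := fun tx r => (f tx.1).[r%:C%C * cis tx.2]) cKI H).
(* The annulus of radii [(1 + d)^-1] and [1 + d] is stable under inversion, and
   [1 - d <= (1 + d)^-1] keeps both radii within [e] of 1. *)
move=> /nbhs_ballP[e /= e0 he]; pose d := Num.min (e / 2) 1.
have d0 : 0 < d by rewrite lt_min divr_gt0 //=.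
have de : d < e.
  by rewrite (@le_lt_trans _ _ (e / 2)) ?ge_min ?lexx // ltr_pdivrMr // ltr_pMr // ltr1n.
exists (1 + d)^-1; first by rewrite invr_gt0 invf_lt1 ?addr_gt0 // ltrDl d0.
move=> t Kt a; rewrite -fmorphV /= invrK normr_sqnorm !ltcR => /andP[a1 a2].
have [x xpi ->] := polar a.
apply: (he (Num.sqrt (sqnorm a)) _ (t, x)); last by split=> //=; rewrite in_itv.
rewrite /ball /= ltr_norml; apply/andP; split; first by lra.
have H : 1 - d <= (1 + d)^-1.
  rewrite -[_^-1]mul1r ler_pdivlMr ?addr_gt0 //; nra.
by lra.
Qed.

(** Bernoulli's inequality for [q^-1 = 1 + c] gives [q^-N - 1 >= N c], so any [N > m / (c e)]
    works. *)
Lemma geometric_small (q e : R) (m : nat) : 0 < q < 1 -> 0 < e ->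
  exists2 N, (0 < N)%N & m%:R * (q ^+ N / (1 - q ^+ N)) < e.
Proof.
move=> /andP[q0 q1] e0; pose c := q^-1 - 1.
have c0 : 0 < c by rewrite subr_gt0 invf_gt1.
have bern N : 1 + N%:R * c <= q^-1 ^+ N.
  elim: N => [|N IH]; first by rewrite mul0r addr0 expr0.
  have qc : q^-1 = c + 1 by rewrite subrK.
  rewrite exprS; move: IH; set Q := _ ^+ N => IH.
  have Nc : 0 <= N%:R * c by rewrite mulr_ge0 ?(ltW c0).
  have : c <= c * Q by rewrite ler_peMr ?(ltW c0) //; lra.
  by rewrite qc -natr1; lra.
pose N := (Num.truncn (m%:R / (c * e))).+1.
have N0 : 0 < N%:R * c by rewrite mulr_gt0.
exists N => //; have qN : 0 < q ^+ N by rewrite exprn_gt0.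
have -> : q ^+ N / (1 - q ^+ N) = (q^-1 ^+ N - 1)^-1.
  rewrite exprVn; have -> : (q ^+ N)^-1 - 1 = (1 - q ^+ N) / q ^+ N by field; rewrite gt_eqF.
  by rewrite invf_div.
rewrite ltr_pdivrMr; last by have := bern N; lra.
apply: (@lt_le_trans _ _ (e * (N%:R * c))); last by rewrite ler_pM2l //; have := bern N; lra.
have -> : e * (N%:R * c) = N%:R * (c * e) by ring.
rewrite -ltr_pdivrMr ?mulr_gt0 //; exact: truncnS_gt.
Qed.

(** [N0] depends neither on the point of [K] nor on the primitive root, because the degrees are
    bounded by [m] and the root-free annulus is common to all of [K]. *)
Lemma log_mean_unif (T : topologicalType) (K : set T) (f : T -> {poly C}) (m : nat) (e : R) :
  0 < e -> compact K -> (forall t, (size (f t) <= m)%N) ->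
  (forall t, K t -> forall i, ctends (nbhs t) (fun s => (f s)`_i) (f t)`_i) ->
  (forall t, K t -> forall w, sqnorm w = 1 -> (f t).[w] != 0) ->
  exists2 N0, (0 < N0)%N & forall N (z : C), (N0 <= N)%N -> N.-primitive_root z ->
    forall t, K t -> `|log_mean N z (f t) - (cnt (f t))%:R| < e%:C%C.
Proof.
move=> e0 cK fm fc fw; have [q q01 fq] := root_gap cK fm fc fw.
have [N0 N00 hN0] := geometric_small m q01 e0; exists N0 => // N z NN0 zN t Kt.
have f0 : f t != 0.
  apply: contraTneq (fw t Kt 1 (sqnorm1 _)) => ->; by rewrite horner0 eqxx.
have q01' : (0 : C) < q%:C%C < 1 by rewrite !ltcR.
apply: le_lt_trans (log_mean_cnt zN q01' f0 (fq t Kt)) _.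
case/andP: q01 => q0 q1.
have E : q%:C%C ^+ N / (1 - q%:C%C ^+ N) = (q ^+ N / (1 - q ^+ N))%:C%C :> C.
  by rewrite fmorph_div rmorphB rmorphXn rmorph1.
rewrite E; have -> : (size (f t))%:R = ((size (f t))%:R : R)%:C%C :> C by rewrite rmorph_nat.
rewrite -rmorphM ltcR; apply: le_lt_trans hN0.
have [qN qN0] : q ^+ N <= q ^+ N0 /\ 0 < q ^+ N.
  by split; [apply: ler_wiXn2l; rewrite ?ltW|rewrite exprn_gt0].
have qN01 : q ^+ N0 < 1 by rewrite exprn_ilt1 ?ltW // -lt0n.
have qN1 : q ^+ N < 1 by apply: le_lt_trans qN01.
apply: ler_pM; rewrite ?ler_nat //.
  by rewrite divr_ge0 ?subr_ge0 ?ltW.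
apply: ler_pM; rewrite ?invr_ge0 ?subr_ge0 ?(ltW qN0) ?(ltW qN1) // lef_pV2 ?posrE ?subr_gt0 //; lra.
Qed.

(* The discrete means are continuous and close to integers, so the root count is constant. *)
Lemma cnt_homotopy (f : R -> {poly C}) (m : nat) :
  (forall t, (size (f t) <= m)%N) ->
  (forall t : R, 0 <= t <= 1 -> forall i, ctends (nbhs t) (fun s => (f s)`_i) (f t)`_i) ->
  (forall t : R, 0 <= t <= 1 -> forall w, sqnorm w = 1 -> (f t).[w] != 0) ->
  cnt (f 0) = cnt (f 1).
Proof.
move=> fm fc fw; pose K : set R := `[0, 1]%classic.
have KE (t : R) : K t -> 0 <= t <= 1 by rewrite /K /= in_itv.
have cK : compact K := @segment_compact R 0 1.
have [N0 N00 hN] := log_mean_unif (m := m) (K := K) (ltac:(lra) : 0 < 1 / 4 :> R)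
  cK fm (fun t Kt => fc t (KE t Kt)) (fun t Kt => fw t (KE t Kt)).
have [z zN] := exists_prim_root C N00.
pose g (t : R) := complex.Re (log_mean N0 z (f t)).
have gn (t : R) : K t -> `|g t - (cnt (f t))%:R| < 1 / 4.
  move=> Kt; have := hN N0 z (leqnn _) zN t Kt.
  rewrite normr_sqnorm ltcR; apply: le_lt_trans.
  have -> : g t - (cnt (f t))%:R = complex.Re (log_mean N0 z (f t) - (cnt (f t))%:R).
    by rewrite raddfB /= -(rmorph_nat (real_complex R)).
  by apply: ler_Re_norm; rewrite normr_sqnorm.
have z1 j : sqnorm (z ^+ j) = 1.
  apply/eqP; rewrite -normr_eq1 normrX; suff -> : `|z| = 1 by rewrite expr1n.
  by apply/eqP; rewrite -(pexpr_eq1 N00) // -normrX (prim_expr_order zN) normr1.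
have gc : {within `[0, 1], continuous g}.
  apply: continuous_in_subspaceT => t; rewrite inE => /KE t01.
  have [H _] : ctends (nbhs t) (fun s => log_mean N0 z (f s)) (log_mean N0 z (f t)); last exact: H.
  apply: ctendsM; first exact: ctends_cst.
  apply: ctends_sum => j; apply: ctendsM.
    apply: ctendsM; first exact: ctends_cst.
    apply: (ctends_horner (m := m)); last exact: ctends_cst.
    - by move=> s; apply: leq_trans (size_poly _ _) (leq_trans (leq_pred _) (fm s)).
    - exact: leq_trans (size_poly _ _) (leq_trans (leq_pred _) (fm t)).
    - move=> i; rewrite coef_deriv -mulr_natr; under eq_fun do rewrite coef_deriv -mulr_natr.
      by apply: ctendsM; [exact: fc|exact: ctends_cst].
  apply: ctendsV; first by rewrite fw.
  by apply: (ctends_horner (m := m)) => //; [exact: fc|exact: ctends_cst].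
have ivt := IVT ler01 gc.
have [K0 K1] : K 0 /\ K 1 by rewrite /K /= !in_itv /= !lexx ler01.
(* [g] stays within [1 / 4] of an integer, so it never takes a half-integer value. If the end counts
   differed, the intermediate value theorem would give the half-integer just above the smaller
   one. *)
have no (n : nat) : Num.min (g 0) (g 1) <= n%:R + 1 / 2 <= Num.max (g 0) (g 1) -> False.
  move/ivt => [t]; rewrite in_itv /= => t01 gt.
  have := gn t; rewrite /K /= in_itv /= gt => /(_ t01).
  rewrite ltr_norml; have [cn|nc] := leqP (cnt (f t)) n => /andP[h1 h2].
    by move: cn; rewrite -(ler_nat R) => cn; lra.
  by move: nc; rewrite -(ler_nat R) -[n.+1%:R]natr1 => nc; lra.
have := gn 0 K0; have := gn 1 K1; rewrite !ltr_norml => /andP[a1 a2] /andP[b1 b2].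
have [lt|lt|//] := ltngtP (cnt (f 0)) (cnt (f 1)).
- exfalso; apply: (no (cnt (f 0))); rewrite ge_min le_max.
  by move: lt; rewrite -(ler_nat R) -natr1 => lt; apply/andP; split; apply/orP; [left|right]; lra.
- exfalso; apply: (no (cnt (f 1))); rewrite ge_min le_max.
  by move: lt; rewrite -(ler_nat R) -natr1 => lt; apply/andP; split; apply/orP; [right|left]; lra.
Qed.

End Homotopy.

(** * Orders of complement points *)

Section Torus.
Variables (R : realType) (I : finType).
Local Notation C := R[i].
Implicit Types (L : seq (C * (I -> nat))) (k : I -> nat) (z : I -> C) (r : I -> R).

(* A polynomial in the variables indexed by I is a list of (coefficient, exponent) pairs. *)
Definition ev L z : C := \sum_(m <- L) m.1 * \prod_i z i ^+ m.2 i.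

Definition upoly k z L : {poly C} :=
  \sum_(m <- L) (m.1 * \prod_i z i ^+ m.2 i) *: 'X^(\sum_i k i * m.2 i).

Lemma upolyE k z L w : (upoly k z L).[w] = ev L (fun i => z i * w ^+ k i).
Proof.
rewrite horner_sum; apply: eq_bigr => m _; rewrite hornerZ hornerXn -mulrA; congr (_ * _).
rewrite -prodrXr -big_split /=; apply: eq_bigr => i _.
by rewrite exprMn exprM.
Qed.

(** The Euler operator [z_i d/dz_i]. *)
Definition euler (i : I) L := [seq (m.1 * (m.2 i)%:R, m.2) | m <- L].

(** The chain rule in logarithmic form: along the curve, [w d/dw] is the sum of the
    [k_i z_i d/dz_i]. This is the source of linearity in [k]. *)
Lemma deriv_upoly k z L w : w * (upoly k z L)^`().[w] =
  \sum_i (k i)%:R * ev (euler i L) (fun i => z i * w ^+ k i).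
Proof.
under eq_bigr => i _ do rewrite /ev big_map mulr_sumr.
rewrite exchange_big /= raddf_sum horner_sum mulr_sumr; apply: eq_bigr => m _.
rewrite /= derivZ derivXn hornerZ hornerMn hornerXn.
under [RHS]eq_bigr => i _ do rewrite -[m.1 * _ * _]mulrA [_%:R * (\prod__ _)]mulrC !mulrA [_%:R * m.1]mulrC -!mulrA [_ * (_%:R * _)]mulrCA.
have -> : \prod_i (z i * w ^+ k i) ^+ m.2 i = \prod_i z i ^+ m.2 i * w ^+ (\sum_i k i * m.2 i).
  by rewrite -prodrXr -big_split /=; apply: eq_bigr => i _; rewrite exprMn exprM.
set n := (\sum_i k i * m.2 i)%N; set p := \prod_i _.
have -> : w * (m.1 * p * (w ^+ n.-1 *+ n)) = m.1 * p * w ^+ n * n%:R.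
  case: n => [|n]; first by rewrite mulr0n !mulr0.
  by rewrite -[_ *+ n.+1]mulr_natr /= exprS; ring.
rewrite /n natr_sum mulr_sumr; apply: eq_bigr => i _.
by rewrite natrM; ring.
Qed.

Lemma size_upoly k L : exists N, forall z, (size (upoly k z L) <= N)%N.
Proof.
elim: L => [|m L [N IH]]; first by exists 0%N => z; rewrite /upoly big_nil size_poly0.
exists (maxn (\sum_i k i * m.2 i).+1 N) => z; rewrite /upoly big_cons.
apply: leq_trans (size_polyD _ _) _; rewrite geq_max !leq_max IH orbT andbT.
by rewrite (leq_trans (size_scale_leq _ _)) ?size_polyXn ?leqnn.
Qed.

Lemma ctends_ev (T : Type) (F : set_system T) {FF : Filter F} L (z : T -> I -> C) (z0 : I -> C) :
  (forall i, ctends F (z^~ i) (z0 i)) -> ctends F (fun t => ev L (z t)) (ev L z0).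
Proof.
move=> zz; apply: ctends_sum => m; apply: ctendsM; first exact: ctends_cst.
by apply: ctends_prod => i; exact: ctendsX.
Qed.

Lemma ctends_upoly (T : Type) (F : set_system T) {FF : Filter F} k L
    (z : T -> I -> C) (z0 : I -> C) j :
  (forall i, ctends F (z^~ i) (z0 i)) ->
  ctends F (fun t => (upoly k (z t) L)`_j) (upoly k z0 L)`_j.
Proof.
move=> zz; rewrite coef_sum; under eq_fun do rewrite coef_sum.
apply: ctends_sum => m; rewrite coefZ; under eq_fun do rewrite coefZ.
apply: ctendsM; last exact: ctends_cst.
apply: ctendsM; first exact: ctends_cst.
by apply: ctends_prod => i; exact: ctendsX.
Qed.

(* For r in the triangle this says that r is off the image of the curve (notin_Fcurve). *)
Definition nv L r := forall z, (forall i, sqnorm (z i) = r i) -> ev L z != 0.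

Lemma nv_upoly L r k z w : nv L r -> (forall i, sqnorm (z i) = r i) -> sqnorm w = 1 ->
  (upoly k z L).[w] != 0.
Proof.
by move=> nr zr w1; rewrite upolyE nr // => i; rewrite sqnormM sqnormX w1 expr1n mulr1.
Qed.

Lemma cnt_upoly_path L k (z : R -> I -> C) :
  (forall t : R, 0 <= t <= 1 -> forall i, ctends (nbhs t) (z^~ i) (z t i)) ->
  (forall t : R, 0 <= t <= 1 -> nv L (fun i => sqnorm (z t i))) ->
  cnt (upoly k (z 0) L) = cnt (upoly k (z 1) L).
Proof.
move=> zc zn; have [N LN] := size_upoly k L.
apply: (cnt_homotopy (f := fun t => upoly k (z t) L) (m := N)) => //.
  by move=> t t01 i; apply: ctends_upoly => j; exact: zc.
by move=> t t01 w w1; apply: nv_upoly w1 => //; exact: zn.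
Qed.

(** The fibre torus is path connected: the phases are interpolated linearly while the moduli stay
    fixed, so the homotopy never leaves the fibre over [r]. *)
Lemma cnt_upoly_phase L r k z z' : nv L r ->
  (forall i, sqnorm (z i) = r i) -> (forall i, sqnorm (z' i) = r i) ->
  cnt (upoly k z L) = cnt (upoly k z' L).
Proof.
move=> nr zr zr'.
have /choice[x zx] : forall i, exists x : R, z i = (Num.sqrt (r i))%:C%C * cis x.
  by move=> i; have [x _ E] := polar (z i); exists x; rewrite -zr.
have /choice[y zy] : forall i, exists y : R, z' i = (Num.sqrt (r i))%:C%C * cis y.
  by move=> i; have [y _ E] := polar (z' i); exists y; rewrite -zr'.
pose p (t : R) i : C := (Num.sqrt (r i))%:C%C * cis (x i + t * (y i - x i)).
have -> : z = p 0 by apply: funext => i; rewrite /p mul0r addr0.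
have -> : z' = p 1 by apply: funext => i; rewrite /p mul1r addrC subrK.
apply: cnt_upoly_path => t t01.
  move=> i; apply: ctendsM; first exact: ctends_cst.
  apply: ctends_cis; apply: cvgD; first exact: cvg_cst.
  by apply: cvgM; [exact: cvg_id|exact: cvg_cst].
move=> u ur; apply: nr => i; rewrite ur /p sqnormM sqnorm_cis mulr1 sqnorm_real.
by rewrite -(zr i) sqr_sqrtr ?sqnorm_ge0.
Qed.

Lemma compact_torus :
  @compact (prod_topology (fun _ : I => R : topologicalType))
    [set x | forall i, `[- pi, pi : R]%classic (x i)].
Proof.
exact: (@tychonoff I (fun=> R : topologicalType) (fun=> `[- pi, pi : R]%classic)
  (fun=> @segment_compact R _ _)).
Qed.

(** One [N0] serves the whole fibre torus, parametrised by the compact cube of phases.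
    [cnt_additive] needs this, since its translates by roots of unity vary with [N]. *)
Lemma log_mean_torus L r k (e : R) : nv L r -> (forall i, 0 <= r i) -> 0 < e ->
  exists2 N0, (0 < N0)%N & forall N (w : C), (N0 <= N)%N -> N.-primitive_root w ->
    forall z, (forall i, sqnorm (z i) = r i) ->
    `|log_mean N w (upoly k z L) - (cnt (upoly k z L))%:R| < e%:C%C.
Proof.
move=> nr r0 e0; have [M LM] := size_upoly k L.
pose T := prod_topology (fun _ : I => R : topologicalType).
pose z (x : T) i : C := (Num.sqrt (r i))%:C%C * cis (x i).
have zr x i : sqnorm (z x i) = r i.
  by rewrite /z sqnormM sqnorm_cis mulr1 sqnorm_real sqr_sqrtr.
have [|x _ w w1|N0 N00 hN] := log_mean_unif (f := fun x : T => upoly k (z x) L) e0 compact_torus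
    (fun x => LM (z x)).
- move=> x _ j; apply: ctends_upoly => i; apply: ctendsM; first exact: ctends_cst.
  by apply: ctends_cis; exact: (@proj_continuous _ (fun _ : I => R : topologicalType) i x).
- by apply: (nv_upoly _ nr).
exists N0 => // N w NN0 wN u ur.
have /choice[x xp] : forall i, exists x : R, - pi <= x <= pi /\ u i = (Num.sqrt (r i))%:C%C * cis x.
  by move=> i; have [x xp E] := polar (u i); exists x; rewrite -ur.
have -> : u = z x by apply: funext => i; have [] := xp i.
by apply: hN => // i /=; have [xi _] := xp i; rewrite in_itv.
Qed.

End Torus.

(** * Additivity of the root count and the order map *)

Section Order.
Variables (R : realType) (I : finType).
Local Notation C := R[i].
Implicit Types (L : seq (C * (I -> nat))) (k : I -> nat) (z : I -> C) (r : I -> R).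

Definition single (i : I) : I -> nat := fun j => (j == i) : nat.

Lemma sum_single (A : pzSemiRingType) (i : I) (F : I -> A) :
  \sum_j (single i j)%:R * F j = F i.
Proof.
rewrite (bigD1 i) //= /single eqxx mul1r big1 ?addr0 // => j /negbTE ->.
by rewrite mul0r.
Qed.

Lemma nat_eq_near (a b : nat) : `|a%:R - b%:R : C| < 1 -> a = b.
Proof.
wlog ab : a b / (a <= b)%N => [H|].
  by have [/H//|/ltnW/H{}H] := leqP a b; rewrite distrC => /H.
rewrite distrC -natrB // normr_nat ltrn1 ltnS leqn0 subn_eq0 => ba.
by apply/eqP; rewrite eqn_leq ab.
Qed.

Lemma log_mean_upoly N (w : C) k z L : log_mean N w (upoly k z L) =
  N%:R^-1 * \sum_(j < N) \sum_i (k i)%:R *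
    (ev (euler i L) (fun i => z i * (w ^+ j) ^+ k i) / ev L (fun i => z i * (w ^+ j) ^+ k i)).
Proof.
congr (_ * _); apply: eq_bigr => j _; rewrite deriv_upoly upolyE mulr_suml.
by apply: eq_bigr => i _; rewrite mulrA.
Qed.

(** Moving along the curve from [w ^+ l] to the j-th root of unity is a translation in the group of
    exponents modulo [N.+1]. The sum over the group absorbs it, so the remaining sums no longer
    involve [k]. *)
Lemma sum_log_mean_torus N (w : C) L z k : N.+1.-primitive_root w ->
  \sum_(l : {ffun I -> 'I_N.+1}) log_mean N.+1 w (upoly k (fun i => z i * w ^+ l i) L) =
  \sum_i (k i)%:R * \sum_(l : {ffun I -> 'I_N.+1})
     (ev (euler i L) (fun i => z i * w ^+ l i) / ev L (fun i => z i * w ^+ l i)).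
Proof.
move=> wN; pose G i (l : {ffun I -> 'I_N.+1}) :=
  ev (euler i L) (fun i => z i * w ^+ l i) / ev L (fun i => z i * w ^+ l i).
(* The translation vector: multiplying coordinate [i] by [(w ^+ j) ^+ k i] adds [j * k i] to its
   exponent modulo [N.+1]. *)
pose s (j : 'I_N.+1) : {ffun I -> 'I_N.+1} := [ffun i => inZp (j * k i)].
have shift (l : {ffun I -> 'I_N.+1}) (j : 'I_N.+1) : (fun i => z i * w ^+ l i * (w ^+ j) ^+ k i) =
    (fun i => z i * w ^+ (l + s j)%R i).
  apply: funext => i; rewrite !ffunE /= -mulrA -exprM -exprD.
  by rewrite -(prim_expr_mod wN) -modnDmr (prim_expr_mod wN) // modnDmr (prim_expr_mod wN).
transitivity (N.+1%:R^-1 * \sum_(l : {ffun I -> 'I_N.+1}) \sum_(j < N.+1) \sum_i (k i)%:R * G i (l + s j)).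
  rewrite mulr_sumr; apply: eq_bigr => l _; rewrite log_mean_upoly; congr (_ * _).
  apply: eq_bigr => j _; apply: eq_bigr => i _; congr (_ * _).
  by rewrite /G -shift.
rewrite exchange_big /=.
transitivity (N.+1%:R^-1 * \sum_(j < N.+1) \sum_i (k i)%:R * \sum_l G i l); last first.
  by rewrite sumr_const card_ord mulrnAr -mulrnAl -[_^-1 *+ _]mulr_natl mulfV ?mul1r // pnatr_eq0.
congr (_ * _); apply: eq_bigr => j _; rewrite exchange_big /=; apply: eq_bigr => i _.
rewrite mulr_sumr (reindex_inj (addIr (- s j))) /=; apply: eq_bigr => l _.
by rewrite subrK.
Qed.

(* Averaging the logarithmic derivative over a discrete torus makes it additive in k. *)
Lemma cnt_additive L r k z : nv L r -> (forall i, sqnorm (z i) = r i) ->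
  cnt (upoly k z L) = (\sum_i k i * cnt (upoly (single i) z L))%N.
Proof.
move=> nr zr; have r0 i : 0 <= r i by rewrite -zr sqnorm_ge0.
(* The mean for [k] costs one error [e] and those for the single coordinates cost [K] of them in
   total; [(1 + K) e < 1] then forces the two integers to agree. *)
pose K := (\sum_i k i)%N; pose e : R := (2 + K%:R)^-1.
have e0 : 0 < e by rewrite invr_gt0 ltr_wpDr.
have [N0 _ hN0] := log_mean_torus k nr r0 e0.
have /choice[N1 hN1] : forall i, exists N1, forall N (w : C), (N1 <= N)%N ->
    N.-primitive_root w -> forall z, (forall i, sqnorm (z i) = r i) ->
    `|log_mean N w (upoly (single i) z L) - (cnt (upoly (single i) z L))%:R| < e%:C%C.
  by move=> i; have [N1 _ h] := log_mean_torus (single i) nr r0 e0; exists N1.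
pose N := (N0 + \sum_i N1 i)%N.
have [w wN] := exists_prim_root C (ltn0Sn N).
have w1 j : sqnorm (w ^+ j) = 1.
  apply/eqP; rewrite -normr_eq1 normrX; suff -> : `|w| = 1 by rewrite expr1n.
  by apply/eqP; rewrite -(pexpr_eq1 (ltn0Sn N)) // -normrX (prim_expr_order wN) normr1.
pose T (l : {ffun I -> 'I_N.+1}) i := z i * w ^+ l i.
have Tr l i : sqnorm (T l i) = r i by rewrite sqnormM w1 mulr1.
pose X k := \sum_l log_mean N.+1 w (upoly k (T l) L).
pose M := #|{ffun I -> 'I_N.+1}|.
have M0 : 0 < M%:R :> C.
  by rewrite ltr0n /M card_ffun expn_gt0 card_ord.
have Xle k' : (forall l, `|log_mean N.+1 w (upoly k' (T l) L) - (cnt (upoly k' (T l) L))%:R| < e%:C%C) ->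
    `|X k' - M%:R * (cnt (upoly k' z L))%:R| <= M%:R * e%:C%C.
  move=> hl; have -> : M%:R * (cnt (upoly k' z L))%:R = \sum_l (cnt (upoly k' (T l) L))%:R :> C.
    rewrite mulr_natl /M -sumr_const; apply: eq_bigr => l _; congr (_%:R).
    exact: (cnt_upoly_phase _ nr).
  rewrite -sumrB mulr_natl /M -sumr_const; apply: le_trans (ler_norm_sum _ _ _) _.
  by apply: ler_sum => l _; exact: ltW.
have XE : X k = \sum_i (k i)%:R * X (single i).
  rewrite /X sum_log_mean_torus //; apply: eq_bigr => i _; congr (_ * _).
  by rewrite sum_log_mean_torus // sum_single.
have Xk : `|X k - M%:R * (cnt (upoly k z L))%:R| <= M%:R * e%:C%C.
  by apply: Xle => l; apply: hN0 => //; rewrite leqW // leq_addr.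
have Xs i : `|X (single i) - M%:R * (cnt (upoly (single i) z L))%:R| <= M%:R * e%:C%C.
  apply: Xle => l; apply: hN1 => //; rewrite leqW // /N (bigD1 i) //=.
  by rewrite addnCA leq_addr.
apply: nat_eq_near; rewrite -(ltr_pM2l M0) mulr1.
have -> : M%:R * `|(cnt (upoly k z L))%:R - (\sum_i k i * cnt (upoly (single i) z L))%:R| =
   `|(M%:R * (cnt (upoly k z L))%:R - X k) +
      \sum_i (k i)%:R * (X (single i) - M%:R * (cnt (upoly (single i) z L))%:R)| :> C.
  rewrite -{1}(gtr0_norm M0) -normrM; congr `|_|.
  under [in RHS]eq_bigr => i _ do rewrite mulrBr mulrCA.
  rewrite sumrB -XE -mulr_sumr mulrBr natr_sum.
  by under [in LHS]eq_bigr => i _ do rewrite natrM; rewrite addrA subrK.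
apply: le_lt_trans (ler_normD _ _) _; rewrite distrC.
have S : `|\sum_i (k i)%:R * (X (single i) - M%:R * (cnt (upoly (single i) z L))%:R)| <=
    K%:R * (M%:R * e%:C%C).
  rewrite natr_sum mulr_suml; apply: le_trans (ler_norm_sum _ _ _) _.
  by apply: ler_sum => i _; rewrite normrM normr_nat ler_wpM2l.
apply: (@le_lt_trans _ _ (M%:R * e%:C%C + K%:R * (M%:R * e%:C%C))); first exact: lerD.
have -> : M%:R * e%:C%C + K%:R * (M%:R * e%:C%C) = M%:R * ((1 + K%:R) * e%:C%C) :> C by ring.
rewrite gtr_pMr //; have -> : (1 + K%:R) * e%:C%C = ((1 + K%:R) * e)%:C%C.
  by rewrite rmorphM rmorphD rmorph1 rmorph_nat.
rewrite -(rmorph1 (real_complex R)) ltcR /e ltr_pdivrMr; last by rewrite ltr_wpDr.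
by rewrite mul1r ltrD2r ltr1n.
Qed.

Definition homog n L := all (fun m => \sum_i m.2 i == n)%N L.

Lemma ev_hom n L z (c : C) : homog n L -> ev L (fun i => c * z i) = c ^+ n * ev L z.
Proof.
elim: L => [_|m L IH /= /andP[/eqP mn /IH E]]; first by rewrite /ev !big_nil mulr0.
rewrite /ev !big_cons -!/(ev _ _) E mulrDr; congr (_ + _).
by rewrite mulrCA -mn -prodrXr -big_split /=; congr (_ * _); apply: eq_bigr => i _; rewrite exprMn.
Qed.

Lemma upoly_hom n L z k (c : C) : homog n L -> upoly k (fun i => c * z i) L = c ^+ n *: upoly k z L.
Proof.
elim: L => [_|m L IH /= /andP[/eqP mn /IH E]]; first by rewrite /upoly !big_nil scaler0.
rewrite /upoly !big_cons -!/(upoly _ _ _) E scalerDr; congr (_ + _).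
rewrite scalerA; congr (_ *: _).
by rewrite mulrCA -mn -prodrXr -big_split /=; congr (_ * _); apply: eq_bigr => i _; rewrite exprMn.
Qed.

Lemma upoly1_hom n L z : homog n L -> upoly (fun=> 1%N) z L = ev L z *: 'X^n.
Proof.
elim: L => [_|m L IH /= /andP[/eqP mn /IH E]]; first by rewrite /upoly /ev !big_nil scale0r.
rewrite /upoly /ev !big_cons -!/(upoly _ _ _) -!/(ev _ _) E scalerDl; congr (_ *: _ + _).
by rewrite -mn; congr ('X^_); apply: eq_bigr => i _; rewrite mul1n.
Qed.

Lemma upoly_neq0 L r k z : nv L r -> (forall i, sqnorm (z i) = r i) -> upoly k z L != 0.
Proof.
move=> nr zr; have := nv_upoly k nr zr (sqnorm1 R); apply: contraNneq => ->.
by rewrite horner0.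
Qed.

Definition vec r : I -> C := fun i => (Num.sqrt (r i))%:C%C.

Lemma sqnorm_vec r : (forall i, 0 <= r i) -> forall i, sqnorm (vec r i) = r i.
Proof. by move=> r0 i; rewrite sqnorm_real sqr_sqrtr. Qed.

(** The choice of the real point [vec r] in the fibre is immaterial when [nv L r] holds, by
    [ord_cnt]. *)
Definition ord L r (i : I) : nat := cnt (upoly (single i) (vec r) L).

Lemma ord_cnt L r z i : nv L r -> (forall i, sqnorm (z i) = r i) ->
  cnt (upoly (single i) z L) = ord L r i.
Proof.
move=> nr zr; apply: (cnt_upoly_phase _ nr) => // j; apply: sqnorm_vec => l.
by rewrite -zr sqnorm_ge0.
Qed.

(** With all weights 1, the restriction is a nonzero multiple of ['X^n], whose roots all lie at 0;
    additivity does the rest. *)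
Lemma sum_ord n L r : homog n L -> nv L r -> (forall i, 0 <= r i) -> (\sum_i ord L r i = n)%N.
Proof.
move=> Ln nr r0; have zr := sqnorm_vec r0.
have := cnt_additive (fun=> 1%N) nr zr; under eq_bigr do rewrite mul1n; move=> <-.
by rewrite (upoly1_hom _ Ln) cntZXn // nr.
Qed.

(** This lets squared moduli be used projectively, without normalising their sum to 1. *)
Lemma nv_scale n L r (c : R) : homog n L -> 0 < c -> nv L r -> nv L (fun i => c * r i).
Proof.
move=> Ln c0 nr z zr; pose s : C := (Num.sqrt c)%:C%C.
have sc : sqnorm s = c by rewrite sqnorm_real sqr_sqrtr // ltW.
have s0 : s != 0 by rewrite -sqnorm_eq0 sc gt_eqF.
have -> : z = (fun i => s * (z i / s)) by apply: funext => i; rewrite mulrC divfK.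
rewrite (ev_hom _ _ Ln) mulf_neq0 ?expf_neq0 // nr // => i.
apply: (mulIf (x := c)); first by rewrite gt_eqF.
by rewrite -{1}sc -sqnormM divfK // zr mulrC.
Qed.

Lemma ord_scale n L r (c : R) : homog n L -> 0 < c -> nv L r -> (forall i, 0 <= r i) ->
  ord L (fun i => c * r i) = ord L r.
Proof.
move=> Ln c0 nr r0; apply: funext => i; rewrite /ord.
have -> : vec (fun i => c * r i) = (fun i => (Num.sqrt c)%:C%C * vec r i).
  by apply: funext => j; rewrite /vec sqrtrM ?ltW // rmorphM.
rewrite (upoly_hom _ _ _ Ln) cntZ //; last exact: upoly_neq0 nr (sqnorm_vec r0).
by rewrite expf_neq0 // -sqnorm_eq0 sqnorm_real sqr_sqrtr ?ltW // gt_eqF.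
Qed.

Lemma ord_path L (r : R -> I -> R) :
  (forall t : R, 0 <= t <= 1 -> forall i, (r^~ i) x @[x --> t] --> r t i) ->
  (forall t, 0 <= t <= 1 -> forall i, 0 <= r t i) ->
  (forall t, 0 <= t <= 1 -> nv L (r t)) ->
  ord L (r 0) = ord L (r 1).
Proof.
move=> rc r0 rn; apply: funext => i.
apply: (@cnt_upoly_path _ _ L (single i) (fun t => vec (r t))) => t t01.
  move=> j; apply: ctends_real; apply: continuous_cvg; last exact: rc.
  exact: sqrt_continuous.
by under eq_fun => j do rewrite (sqnorm_vec (r0 t t01)); exact: rn.
Qed.

(** Logarithmic convexity in the direction [k]. By additivity, equal orders at both ends give
    equally many roots in the discs of radius 1 and [sqrt q], so the annulus between them is
    root-free. The square root enters because [r] records squared moduli. *)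
Lemma nv_convex L r k (q : R) : 1 <= q -> (forall i, 0 <= r i) ->
  nv L r -> nv L (fun i => r i * q ^+ k i) -> ord L (fun i => r i * q ^+ k i) = ord L r ->
  forall s, 1 <= s <= q -> nv L (fun i => r i * s ^+ k i).
Proof.
move=> q1 r0 nr nq eo s /andP[s1 sq] u ur.
(* [cnt_annulus] excludes the outer circle, so the end point [s = q] uses its own hypothesis. *)
case: (eqVneq s q) ur => [->|sq'] ur; first exact: nq.
have {}sq : s < q by rewrite lt_neqAle sq'.
pose h (x : R) : C := (Num.sqrt x)%:C%C.
have hh x : 1 <= x -> sqnorm (h x) = x.
  by move=> x1; rewrite sqnorm_real sqr_sqrtr // (le_trans _ x1).
have h0 x : 1 <= x -> h x != 0.
  by move=> x1; rewrite -sqnorm_eq0 hh // gt_eqF // (lt_le_trans ltr01).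
pose v i := u i / h s ^+ k i.
have vr i : sqnorm (v i) = r i.
  apply: (mulIf (x := s ^+ k i)); first by rewrite expf_neq0 // gt_eqF // (lt_le_trans ltr01).
  by rewrite -{1}(hh s s1) -sqnormX -sqnormM divfK ?expf_neq0 ?h0.
have -> : u = (fun i => v i * h s ^+ k i).
  by apply: funext => i; rewrite divfK // expf_neq0 // h0.
rewrite -upolyE; have P0 : upoly k v L != 0 by apply: upoly_neq0 nr vr.
have hq : 1 <= h q by rewrite -(rmorph1 (real_complex R)) lecR -sqrtr1 ler_sqrt ?(le_trans _ q1).
have cq : upoly k v L \Po (h q *: 'X) = upoly k (fun i => v i * h q ^+ k i) L.
  rewrite raddf_sum; apply: eq_bigr => m _ /=; rewrite linearZ /= rmorphXn /= comp_polyX exprZn scalerA.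
  congr (_ *: _); rewrite -mulrA; congr (_ * _); rewrite -prodrXr -big_split /=.
  by apply: eq_bigr => i _; rewrite [RHS]exprMn -exprM.
apply: (cnt_annulus hq P0).
  rewrite cq (cnt_additive k nq); last by move=> i; rewrite sqnormM sqnormX vr hh.
  rewrite (cnt_additive k nr vr); apply: eq_bigr => i _; congr (_ * _)%N.
  rewrite (ord_cnt _ nr vr) (ord_cnt (r := fun i => r i * q ^+ k i)) ?eo //.
  by move=> j; rewrite sqnormM sqnormX vr hh.
rewrite normr_sqnorm hh // -(rmorph1 (real_complex R)) lecR ltcR.
by rewrite -{1}sqrtr1 ler_sqrt ?ltr_sqrt ?s1 // ?(lt_le_trans ltr01) // (le_trans _ s1).
Qed.

(** Any [u] over the shrunk moduli comes from some [v] over [r] by multiplying the j-th coordinate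
    by a number [a] of the open disc, where the restriction has no root. *)
Lemma nv_shrink L r j : (forall i, 0 <= r i) -> nv L r -> ord L r j = 0%N ->
  forall s, 0 <= s <= 1 -> nv L (fun i => if i == j then s * r i else r i).
Proof.
move=> r0 nr oj s /andP[s0 s1] u ur.
have [sE|s1'] := eqVneq s 1.
  by apply: nr => i; rewrite ur sE mul1r if_same.
have {}s1 : s < 1 by rewrite lt_neqAle s1'.
have [v [vr [a [a1 ua]]]] : exists v : I -> C, (forall i, sqnorm (v i) = r i) /\
    exists a : C, sqnorm a < 1 /\ u = (fun i => v i * a ^+ single j i).
  (* For [s = 0] the phase of the j-th coordinate is lost; any value of the right modulus serves in
     [v], with [a = 0] and [0 ^+ 0 = 1] elsewhere. *)
  have [sE|s0'] := eqVneq s 0.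
    exists (fun i => if i == j then (Num.sqrt (r i))%:C%C else u i); split.
      by move=> i; case: ifP => ij; rewrite ?sqnorm_real ?sqr_sqrtr // ur ij.
    exists 0; split; first by rewrite sqnorm0.
    apply: funext => i; rewrite /single; have := ur i; case: eqP => _.
      by rewrite sE mul0r expr1 mulr0 => /eqP; rewrite sqnorm_eq0 => /eqP.
    by rewrite expr0 mulr1.
  have hs : sqnorm ((Num.sqrt s)%:C%C : C) = s by rewrite sqnorm_real sqr_sqrtr.
  have h0 : (Num.sqrt s)%:C%C != 0 :> C by rewrite -sqnorm_eq0 hs.
  exists (fun i => u i / (Num.sqrt s)%:C%C ^+ single j i); split.
    move=> i; apply: (mulIf (x := s ^+ single j i)); first by rewrite expf_neq0.
    have E : s ^+ single j i = sqnorm ((Num.sqrt s)%:C%C ^+ single j i : C) by rewrite sqnormX hs.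
    rewrite [X in _ * X = _]E -sqnormM divfK ?expf_neq0 // ur /single.
    by case: eqP => _; rewrite ?expr1 ?expr0 ?mulr1 // mulrC.
  exists (Num.sqrt s)%:C%C; split; first by rewrite hs.
  by apply: funext => i; rewrite divfK ?expf_neq0.
rewrite ua -upolyE; apply: cnt_eq0; last by rewrite normr_lt1.
  exact: upoly_neq0 nr vr.
by rewrite (ord_cnt _ nr vr).
Qed.

End Order.

Definition o0 : 'I_3 := @Ordinal 3 0 isT.
Definition o1 : 'I_3 := @Ordinal 3 1 isT.
Definition o2 : 'I_3 := @Ordinal 3 2 isT.

Lemma I3_ind (P : 'I_3 -> Prop) : P o0 -> P o1 -> P o2 -> forall i, P i.
Proof.
move=> P0 P1 P2 [[|[|[|//]]] i3].
- by have -> : Ordinal i3 = o0 by apply: val_inj.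
- by have -> : Ordinal i3 = o1 by apply: val_inj.
- by have -> : Ordinal i3 = o2 by apply: val_inj.
Qed.

Lemma sum_I3 (V : nmodType) (F : 'I_3 -> V) : \sum_i F i = F o0 + F o1 + F o2.
Proof.
rewrite !big_ord_recl big_ord0 addr0 addrA; congr (F _ + F _ + F _); exact: val_inj.
Qed.

Lemma prod_I3 (V : pzSemiRingType) (F : 'I_3 -> V) : \prod_i F i = F o0 * F o1 * F o2.
Proof.
rewrite !big_ord_recl big_ord0 mulr1 mulrA; congr (F _ * F _ * F _); exact: val_inj.
Qed.

(** * Holes and orders *)

Section General.

(** [W] and its complement are both relatively open in [A], so [W] cuts every connected subset of
    [A] in a relatively clopen piece. *)
Lemma component_locally_constant (T : topologicalType) (A W : set T) (x : T) :
  (forall y, A y -> W y -> \forall z \near y, A z -> W z) ->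
  (forall y, A y -> ~ W y -> \forall z \near y, A z -> ~ W z) ->
  W x -> connected_component A x `<=` W.
Proof.
move=> Wo Wc Wx y [B [Bx BA cB] By].
suff E : B `&` W = B by move: By; rewrite -E => -[].
apply: cB; first by exists x.
- exists (interior [set y | A y -> W y]); first exact: open_interior.
  apply/seteqP; split=> z [Bz Wz]; split=> //; first by apply: Wo => //; exact: BA.
  by apply: (nbhs_singleton Wz); exact: BA.
- exists (~` (interior [set y | A y -> ~ W y])).
    by apply: open_closedC; exact: open_interior.
  apply/seteqP; split=> z [Bz Wz]; split=> //.
    by move=> /nbhs_singleton /(_ (BA _ Bz)).
  by apply: contrapT => nW; apply: Wz; apply: Wc => //; exact: BA.
Qed.

Lemma path_component (R : realType) (T : topologicalType) (A : set T) (g : R -> T) (a b : R) :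
  a <= b -> (forall t, a <= t <= b -> g x @[x --> t] --> g t) ->
  (forall t, a <= t <= b -> A (g t)) -> connected_component A (g a) (g b).
Proof.
move=> ab gc gA; pose B := g @` `[a, b]%classic.
exists B; last by exists b => //=; rewrite in_itv /= ab lexx.
split; first by exists a => //=; rewrite in_itv /= ab lexx.
  by move=> _ [t /= tab <-]; apply: gA; move: tab; rewrite in_itv.
apply: connected_continuous_connected; first exact: segment_connected.
by apply: continuous_in_subspaceT => t; rewrite inE /= in_itv /=; exact: gc.
Qed.

(** Rounds the logarithm of [b / a] to base [q] down to a natural number. *)
Lemma expr_bracket (R : realType) (a b q : R) : 0 < a -> a <= b -> 1 < q ->
  exists k, a * q ^+ k <= b < a * q ^+ k.+1.
Proof.
move=> a0 ab q1; have q0 : 0 < q by apply: lt_trans q1.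
have b0 : 0 < b by apply: lt_le_trans ab.
have ex : exists k, b < a * q ^+ k.
  have q01 : 0 < q^-1 < 1 by rewrite invr_gt0 q0 invf_lt1.
  have [N N0 hN] := geometric_small 1 q01 (divr_gt0 a0 b0); exists N.
  have x0 : 0 < q^-1 ^+ N by rewrite exprn_gt0 ?invr_gt0.
  have x1 : q^-1 ^+ N < 1 by rewrite exprn_ilt1 -?lt0n // ?invf_lt1 // ltW // invr_gt0.
  have : q^-1 ^+ N < a / b.
    apply: le_lt_trans hN; rewrite mul1r ler_pdivlMr ?subr_gt0 //.
    by rewrite ler_piMr ?(ltW x0) // lerBlDr lerDl ltW.
  by rewrite exprVn ltr_pdivlMr // mulrC ltr_pdivrMr // exprn_gt0.
have [[|k] bk mk] := ex_minnP ex; first by move: bk; rewrite expr0 mulr1 ltNge ab.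
by exists k; rewrite bk andbT leNgt; apply/negP => /mk; rewrite ltnn.
Qed.

End General.

(** * The triangle, its edges, and regions of constant order *)

Section Triangle.
Variable R : realType.
Local Notation C := R[i].
Local Notation pt := (R * R * R)%type.
Implicit Types (x y : pt) (r : 'I_3 -> R) (z : 'I_3 -> C).

Definition co x (i : 'I_3) : R := [:: x.1.1; x.1.2; x.2]`_i.
Definition tri r : pt := (r o0, r o1, r o2).
Definition mo r : pt := tri (fun i => r i / \sum_j r j).

Lemma co_tri r i : co (tri r) i = r i.
Proof. by move: i; apply: I3_ind. Qed.

Lemma tri_co x : tri (co x) = x.
Proof. by case: x => [[]]. Qed.

Lemma co_mo r : co (mo r) = fun i => (\sum_j r j)^-1 * r i.
Proof. by apply: funext => i; rewrite /mo co_tri mulrC. Qed.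

Lemma mo_co x : \sum_i co x i = 1 -> mo (co x) = x.
Proof.
by move=> x1; rewrite -[RHS]tri_co; congr tri; apply: funext => i; rewrite x1 divr1.
Qed.

Lemma Delta2E x : Delta2 x <-> (forall i, 0 <= co x i) /\ \sum_i co x i = 1.
Proof.
rewrite sum_I3 /Delta2 /= /co /=; split=> [[a [b [c e]]]|[h e]].
  by split=> //; apply: I3_ind.
by split; [exact: (h o0)|split; [exact: (h o1)|split; [exact: (h o2)|]]].
Qed.

Lemma Delta2_mo r : (forall i, 0 <= r i) -> 0 < \sum_i r i -> Delta2 (mo r).
Proof.
move=> r0 s0; apply/Delta2E; rewrite co_mo; split; last by rewrite -mulr_sumr mulVf ?gt_eqF.
by move=> i; rewrite mulr_ge0 // invr_ge0 ltW.
Qed.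

Lemma bdDelta2E x : bdDelta2 x <-> Delta2 x /\ exists i, co x i = 0.
Proof.
split=> [[[|]|] [xD x0]|[xD [j]]].
- by split=> //; exists o0.
- by split=> //; exists o1.
- by split=> //; exists o2.
by move: j; apply: I3_ind => x0; [left; left|left; right|right].
Qed.

Lemma co_continuous i : continuous (co^~ i).
Proof.
move: i; apply: I3_ind => x; rewrite /co /=.
- exact: (cvg_comp _ _ cvg_fst cvg_fst).
- exact: (cvg_comp _ _ cvg_fst cvg_snd).
- exact: cvg_snd.
Qed.

Lemma cvg_co (T : Type) (F : set_system T) {FF : Filter F} (f : T -> pt) x i :
  f @ F --> x -> (fun t => co (f t) i) @ F --> co x i.
Proof. by move=> fx; exact: (cvg_comp _ _ fx (@co_continuous i x)). Qed.

Lemma cvg_tri (T : Type) (F : set_system T) {FF : Filter F} (f : T -> 'I_3 -> R) r :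
  (forall i, f^~ i @ F --> r i) -> (fun t => tri (f t)) @ F --> tri r.
Proof. move=> fr; exact: (cvg_pair (cvg_pair (fr o0) (fr o1)) (fr o2)). Qed.

Lemma cvg_mo (T : Type) (F : set_system T) {FF : Filter F} (f : T -> 'I_3 -> R) r :
  (forall i, f^~ i @ F --> r i) -> \sum_i r i != 0 -> (fun t => mo (f t)) @ F --> mo r.
Proof.
move=> fr s0; apply: (cvg_tri (f := fun t i => f t i / \sum_j f t j)) => i.
apply: cvgM => //; apply: cvgV => //; rewrite sum_I3.
under eq_fun do rewrite sum_I3.
by apply: cvgD => //; apply: cvgD.
Qed.

Lemma ball_co x y (e : R) : ball x e y <-> forall i, `|co x i - co y i| < e.
Proof.
split=> [[[a b] c]|h]; first by apply: I3_ind.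
by split; [split|]; [exact: (h o0)|exact: (h o1)|exact: (h o2)].
Qed.

Definition lin x y (t : R) : pt := tri (fun i => co x i + t * (co y i - co x i)).

Lemma co_lin x y t i : co (lin x y t) i = co x i + t * (co y i - co x i).
Proof. by rewrite co_tri. Qed.

Lemma ball_lin a x y (e t : R) : 0 <= t <= 1 -> ball a e x -> ball a e y -> ball a e (lin x y t).
Proof.
move=> /andP[t0 t1] /ball_co ax /ball_co ay; apply/ball_co => i; rewrite co_lin.
have -> : co a i - (co x i + t * (co y i - co x i)) =
  (1 - t) * (co a i - co x i) + t * (co a i - co y i) by ring.
have := ax i; have := ay i; rewrite !ltr_norml => /andP[h1 h2] /andP[h3 h4].
have [->|t0'] := eqVneq t 0; first by apply/andP; split; lra.
have {}t0 : 0 < t by rewrite lt_neqAle eq_sym t0'.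
by apply/andP; split; nra.
Qed.

Lemma cvg_lin x y (t : R) : lin x y s @[s --> t] --> lin x y t.
Proof.
apply: cvg_tri => i; apply: cvgD; first exact: cvg_cst.
by apply: cvgM; [exact: cvg_id|exact: cvg_cst].
Qed.

Lemma moE (z1 z2 z3 : C) : moment z1 z2 z3 = mo (fun i => sqnorm [:: z1; z2; z3]`_i).
Proof. by rewrite /mo sum_I3. Qed.

Section Curve.
Variables (n : nat) (L : seq (C * ('I_3 -> nat))) (P : C -> C -> C -> C).
Hypothesis PE : forall z1 z2 z3 : C, P z1 z2 z3 = ev L (fun i => [:: z1; z2; z3]`_i).
Hypothesis Ln : homog n L.
Hypothesis edge_pos : forall r, (forall i, 0 <= r i) -> (exists j, r j = 0) ->
  (exists j, r j != 0) -> ev L (vec r) != 0.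

Lemma notin_Fcurve x : Delta2 x -> (~ Fcurve P x <-> nv L (co x)).
Proof.
move=> /Delta2E[x0 x1]; split=> [nF z zx|nx [z1 [z2 [z3 [zn0 [Pz xz]]]]]].
  apply/negP => /eqP Lz; apply: nF; exists (z o0), (z o1), (z o2).
  have E : (fun i : 'I_3 => [:: z o0; z o1; z o2]`_i) = z by apply: funext; apply: I3_ind.
  split; [|split].
  - apply/negP => /eqP[z0 z1 z2]; move: x1.
    by rewrite sum_I3 -!zx z0 z1 z2 sqnorm0 !addr0 => /esym/eqP; rewrite oner_eq0.
  - by rewrite PE E.
  - rewrite moE -[LHS](mo_co x1); congr mo; apply: funext.
    by apply: I3_ind; rewrite -zx.
set z := (fun i : 'I_3 => [:: z1; z2; z3]`_i); rewrite PE -/z in Pz.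
have s0 : 0 < \sum_i sqnorm (z i).
  rewrite lt0r sumr_ge0 ?andbT; last by move=> i _; exact: sqnorm_ge0.
  apply: contra zn0; rewrite psumr_eq0 => [/allP h|i _]; last exact: sqnorm_ge0.
  have zz i : z i = 0 by apply/eqP; rewrite -sqnorm_eq0; apply: h; rewrite mem_index_enum.
  by apply/eqP; congr (_, _, _); [exact: (zz o0)|exact: (zz o1)|exact: (zz o2)].
suff : ev L z != 0 by rewrite Pz eqxx.
by apply: (nv_scale Ln s0 nx) => i; rewrite xz moE co_mo mulrA mulfV ?mul1r // gt_eqF.
Qed.

Let A : set pt := Delta2 (R := R) `\` Fcurve P.

Lemma AE x : A x <-> Delta2 x /\ nv L (co x).
Proof. by split=> -[xD] /(notin_Fcurve xD). Qed.

Lemma A_mo r : (forall i, 0 <= r i) -> 0 < \sum_i r i -> nv L r -> A (mo r).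
Proof.
move=> r0 s0 nr; apply/AE; split; first exact: Delta2_mo.
by rewrite co_mo; apply: (nv_scale Ln) => //; rewrite invr_gt0.
Qed.

Lemma ctends_ev_polar (T : Type) (F : set_system T) {FF : Filter F} (f g : T -> 'I_3 -> R) (a b : 'I_3 -> R) :
  (forall i, f^~ i @ F --> a i) -> (forall i, g^~ i @ F --> b i) ->
  ctends F (fun t => ev L (fun i => (Num.sqrt (f t i))%:C%C * cis (g t i)))
    (ev L (fun i => (Num.sqrt (a i))%:C%C * cis (b i))).
Proof.
move=> fa gb; apply: ctends_ev => i; apply: ctendsM; last exact: ctends_cis.
by apply: ctends_real; apply: continuous_cvg => //; exact: sqrt_continuous.
Qed.

(** The fibres over all nearby [y] are images of one compact cube of phases, to which the tube lemma
    applies. *)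
Lemma nv_near x : nv L (co x) -> (forall i, 0 <= co x i) -> \forall y \near x, nv L (co y).
Proof.
move=> nx x0.
pose z (u : prod_topology (fun _ : 'I_3 => R : topologicalType)) y (i : 'I_3) : C :=
  (Num.sqrt (co y i))%:C%C * cis (u i).
have := @near_compact_neq0 R _ _ pt (nbhs x) _ (fun u y => ev L (z u y))
  (fun u => ev L (z u x)) (@compact_torus R 'I_3).
have H : forall u : prod_topology (fun _ : 'I_3 => R : topologicalType), [set u | forall i, `[- pi, pi : R]%classic (u i)] u -> ev L (z u x) != 0 /\
    ctends (filter_prod (nbhs u) (nbhs x)) (fun p => ev L (z p.1 p.2)) (ev L (z u x)).
  move=> u _; split.
    by apply: nx => i; rewrite sqnormM sqnorm_cis mulr1 sqnorm_real sqr_sqrtr.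
  have FF : Filter (filter_prod (nbhs u) (nbhs x)).
    by apply: filter_prod_filter; exact: nbhs_filter.
  apply: (@ctends_ev_polar _ _ FF (fun p => co p.2) (fun p => p.1) (co x) u) => i.
    by apply: cvg_co; exact: cvg_snd.
  have c : (fun v : prod_topology (fun _ : 'I_3 => R : topologicalType) => v i) @ nbhs u --> u i.
    exact: (@proj_continuous _ (fun _ : 'I_3 => R : topologicalType) i u).
  exact: (cvg_comp fst (fun v : prod_topology (fun _ : 'I_3 => R : topologicalType) => v i) cvg_fst c).
move=> /(_ (nbhs_filter x) H); apply: filterS => y hy w wy.
have /choice[u up] : forall i, exists u : R, - pi <= u <= pi /\ w i = (Num.sqrt (co y i))%:C%C * cis u.
  by move=> i; have [u up E] := polar (w i); exists u; rewrite -wy.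
have -> : w = z u y by apply: funext => i; have [] := up i.
by apply: hy => i /=; have [ui _] := up i; rewrite in_itv.
Qed.

(** The ball is taken in the ambient space: [region_connected] uses a point whose coordinates need
    not add up to 1. *)
Lemma ord_near x : nv L (co x) -> (forall i, 0 < co x i) -> exists2 e : R, 0 < e &
  forall y, ball x e y -> [/\ forall i, 0 < co y i, nv L (co y) & ord L (co y) = ord L (co x)].
Proof.
move=> nx x0; have nn := nv_near nx (fun i => ltW (x0 i)).
have pos : \forall y \near x, forall i, 0 < co y i.
  have h i : \forall y \near x, 0 < co y i.
    have c : (fun y => co y i) @ nbhs x --> co x i by exact: co_continuous.
    exact: (@cvgr_gt R pt (nbhs x) _ (fun y => co y i) (co x i) c 0 (x0 i)).
  by near=> y; apply: I3_ind; near: y; exact: h.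
have /nbhs_ballP[e /= e0 he] : \forall y \near x, nv L (co y) /\ forall i, 0 < co y i.
  by apply: filterI.
exists e => // y xy; have [ny y0] := he _ xy; split=> //.
have seg t : 0 <= t <= 1 -> ball x e (lin y x t).
  by move=> t01; apply: ball_lin => //; exact: ballxx.
have l0 : lin y x 0 = y.
  by rewrite -[RHS]tri_co; congr tri; apply: funext => i; rewrite mul0r addr0.
have l1 : lin y x 1 = x.
  by rewrite -[RHS]tri_co; congr tri; apply: funext => i; rewrite mul1r addrC subrK.
rewrite -l0 -[in RHS]l1; apply: (@ord_path _ _ L (fun t => co (lin y x t))) => t t01.
- move=> i; exact: (cvg_comp _ _ (@cvg_lin y x t) (@co_continuous i (lin y x t))).
- by move=> i; have [_ /(_ i)/ltW] := he _ (seg t t01).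
- by have [] := he _ (seg t t01).
Unshelve. all: by end_near. Qed.

(** Over [x] the j-th coordinate is 0, so multiplying it by [w] changes nothing and the limit is the
    nonzero value given by [edge_pos]. The tube lemma over the closed disc of all [w], in polar
    form, keeps the disc root-free for nearby [y]. *)
Lemma ord_edge_near x j : Delta2 x -> co x j = 0 -> \forall y \near x, ord L (co y) j = 0%N.
Proof.
move=> /Delta2E[x0 x1] xj.
have ex : ev L (vec (co x)) != 0.
  apply: edge_pos => //; first by exists j.
  apply: contrapT => h; have : \sum_i co x i = 0.
    apply: big1 => i _; apply/eqP/negPn/negP => xi; apply: h; by exists i.
  by rewrite x1 => /eqP; rewrite oner_eq0.
pose z (p : R * R) y (i : 'I_3) : C := vec (co y) i * (p.1%:C%C * cis p.2) ^+ single j i.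
pose K : set (R * R) := `[0, 1]%classic `*` `[- pi, pi]%classic.
have cK : compact K by apply: compact_setX; exact: segment_compact.
have zx p : z p x = vec (co x).
  apply: funext => i; rewrite /z /single; case: eqP => [->|_]; last by rewrite expr0 mulr1.
  by rewrite /vec xj sqrtr0 mul0r.
have H p : K p -> ev L (vec (co x)) != 0 /\
    ctends (filter_prod (nbhs p) (nbhs x)) (fun q => ev L (z q.1 q.2)) (ev L (vec (co x))).
  move=> _; split=> //; rewrite -(zx p); apply: ctends_ev => i; apply: ctendsM.
    apply: ctends_real; apply: continuous_cvg; first exact: sqrt_continuous.
    by apply: cvg_co; exact: cvg_snd.
  apply: ctendsX; apply: ctendsM.
    by apply: ctends_real; case: p => a b; exact: (cvg_comp _ _ cvg_fst cvg_fst).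
  by apply: ctends_cis; case: p => a b; exact: (cvg_comp _ _ cvg_fst cvg_snd).
have := near_compact_neq0 (f := fun p y => ev L (z p y)) cK H; move=> /(_ (nbhs_filter x)).
apply: filterS => y hy.
have hw w : `|w| < 1 -> (upoly (single j) (vec (co y)) L).[w] != 0.
  rewrite normr_lt1 upolyE => w1; have [u up ->] := polar w.
  apply: (hy (Num.sqrt (sqnorm w), u)); split => /=; rewrite in_itv //= sqrtr_ge0 -sqrtr1.
  by rewrite ler_sqrt ?ltW.
apply: eq0_cnt => //; have := hw 0; rewrite normr0 ltr01 => /(_ isT).
by apply: contraNneq => ->; rewrite horner0.
Qed.

Definition region (e : 'I_3 -> nat) : set pt :=
  [set x | [/\ Delta2 x, forall i, 0 < co x i, nv L (co x) & ord L (co x) = e]].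

Lemma region_A e x : region e x -> A x.
Proof. by move=> [xD _ nx _]; apply/AE. Qed.

(** The order is locally constant at positive points; near a boundary point some coordinate of the
    order is 0, which a positive [e] excludes. *)
Lemma region_component e x : (forall i, (0 < e i)%N) -> region e x ->
  connected_component A x `<=` region e.
Proof.
move=> e0; apply: component_locally_constant => y /AE[yD ny].
  move=> [_ y0 _ ye]; have [d d0 hd] := ord_near ny y0.
  apply/nbhs_ballP; exists d => // z yz [zD _]; have [z0 nz zo] := hd _ yz.
  by split=> //; rewrite zo.
move=> ye; have [y0|] := pselect (forall i, 0 < co y i).
  have [d d0 hd] := ord_near ny y0.
  apply/nbhs_ballP; exists d => // z yz [zD _] [_ _ _ ze]; have [z0 nz zo] := hd _ yz.
  by apply: ye; split=> //; rewrite -zo.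
move=> /existsNP[i /negP]; rewrite -leNgt => yi.
have yi0 : co y i = 0.
  by apply/eqP; rewrite eq_le yi; have /Delta2E[/(_ i)] := yD.
have := ord_edge_near yD yi0; apply: filterS => z zi _ [_ _ _ ze].
by have := e0 i; rewrite -ze zi.
Qed.

(** The path is the monomial curve [t -> (x_i t^(k_i))] from [x] to a point [y'] close to a multiple
    of [y], handled by [nv_convex], followed by a straight segment inside a ball around [y]. *)
Lemma region_connected e x y : region e x -> region e y -> connected_component A x y.
Proof.
move=> [xD x0 nx xe] [yD y0 ny ye].
have /Delta2E[_ x1] := xD; have /Delta2E[_ y1] := yD.
have [d d0 hd] := ord_near ny y0.
have y_le1 i : co y i <= 1.
  by rewrite -y1 (bigD1 i) //= lerDl sumr_ge0 // => j _; exact: ltW.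
(* The sum bounds each ratio, so [c y] dominates [x] coordinatewise and all exponents can be
   natural. *)
pose c := \sum_i co x i / co y i.
have c_ge i : co x i <= c * co y i.
  rewrite -ler_pdivrMr // /c (bigD1 i) //= lerDl sumr_ge0 // => j _.
  by rewrite divr_ge0 ?ltW.
have c0 : 0 < c.
  by have := lt_le_trans (x0 o0) (c_ge o0); rewrite pmulr_lgt0.
(* Rounding down will give [y' <= y < q y'] coordinatewise; since [y' <= y <= 1], the gap is below
   [q - 1 = d / 2]. *)
pose q := 1 + d / 2.
have q1 : 1 < q by rewrite ltrDl divr_gt0.
have /choice[k hk] : forall i, exists k, co x i * q ^+ k <= c * co y i < co x i * q ^+ k.+1.
  by move=> i; exact: expr_bracket.
pose s i := co x i * q ^+ k i.
have s0 i : 0 < s i by rewrite mulr_gt0 // exprn_gt0 // (lt_trans ltr01).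
pose y' := tri (fun i => c^-1 * s i).
have yy' : ball y d y'.
  apply/ball_co => i; rewrite co_tri; have /andP[h1 h2] := hk i.
  have t1 : c^-1 * s i <= co y i by rewrite mulrC ler_pdivrMr // mulrC.
  have t2 : co y i < (c^-1 * s i) * q.
    by rewrite -mulrA mulrC ltr_pdivlMr // mulrC /s -mulrA -exprSr.
  rewrite ger0_norm ?subr_ge0 //.
  have t3 := y_le1 i; have t4 := y0 i.
  have t5 : 0 < c^-1 * s i by rewrite mulr_gt0 // invr_gt0.
  move: t1 t2 t5; rewrite /q; set w := c^-1 * s i => t1 t2 t5; nra.
have [y'0 ny' y'e] := hd _ yy'.
have co_y' : co y' = fun i => c^-1 * s i by apply: funext => i; rewrite co_tri.
have sE : s = fun i => c * co y' i.
  by apply: funext => i; rewrite co_y' mulrA mulfV ?mul1r // gt_eqF.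
have ns : nv L s by rewrite sE; exact: (nv_scale Ln).
have os : ord L s = e.
  by rewrite sE (ord_scale Ln) // ?y'e ?ye // => i; exact: ltW.
have sum0 (r : 'I_3 -> R) : (forall i, 0 < r i) -> 0 < \sum_i r i.
  by move=> r0; rewrite sum_I3 !addr_gt0.
have moy' : mo s = mo (co y').
  rewrite sE; congr tri; apply: funext => i; rewrite -mulr_sumr invfM mulrACA mulfV ?mul1r //.
  by rewrite gt_eqF.
apply: (@connected_component_trans _ _ (mo s)).
  have -> : x = mo (fun i => co x i * 1 ^+ k i).
    by rewrite -[LHS](mo_co x1); congr mo; apply: funext => i; rewrite expr1n mulr1.
  apply: (@path_component _ _ _ (fun t => mo (fun i => co x i * t ^+ k i)) 1 q); first exact: ltW.
    move=> t /andP[t1 tq]; apply: cvg_mo.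
      move=> i; apply: cvgM; first exact: cvg_cst.
      by have h := @exprn_continuous R (k i); exact: h.
    by rewrite gt_eqF // sum0 // => i; rewrite mulr_gt0 // exprn_gt0 // (lt_le_trans ltr01).
  move=> t t1q; have /andP[t1 tq] := t1q.
  have r0 i : 0 < co x i * t ^+ k i by rewrite mulr_gt0 // exprn_gt0 // (lt_le_trans ltr01).
  apply: A_mo; [by move=> i; exact: ltW|exact: sum0|].
  apply: (nv_convex (q := q)) => //; first exact: ltW.
    by move=> i; exact: ltW.
  by rewrite -/s os.
rewrite moy'; have l0 : lin y' y 0 = y'.
  by rewrite -[RHS]tri_co; congr tri; apply: funext => i; rewrite mul0r addr0.
have l1 : lin y' y 1 = y.
  by rewrite -[RHS]tri_co; congr tri; apply: funext => i; rewrite mul1r addrC subrK.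
have -> : y = mo (co (lin y' y 1)) by rewrite l1 mo_co.
have -> : mo (co y') = mo (co (lin y' y 0)) by rewrite l0.
have seg t : 0 <= t <= 1 -> ball y d (lin y' y t).
  by move=> t01; apply: ball_lin => //; exact: ballxx.
apply: (@path_component _ _ _ (fun t => mo (co (lin y' y t))) 0 1) => // t t01.
  apply: cvg_mo; first by move=> i; apply: cvg_co; exact: cvg_lin.
  by have [h _ _] := hd _ (seg t t01); rewrite gt_eqF // sum0.
have [h nh _] := hd _ (seg t t01).
by apply: A_mo; [move=> i; exact: ltW|exact: sum0|].
Qed.

Lemma component_edge x j : A x -> (forall i, 0 < co x i) -> ord L (co x) j = 0%N ->
  exists2 y, connected_component A x y & co y j = 0.
Proof.
move=> /AE[xD nx] x0 xj; have /Delta2E[_ x1] := xD.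
pose r (t : R) i := if i == j then (1 - t) * co x i else co x i.
have r0 t : t <= 1 -> forall i, 0 <= r t i.
  by move=> t1 i; rewrite /r; case: ifP => _; rewrite ?mulr_ge0 ?subr_ge0 // ltW.
have s0 t : t <= 1 -> 0 < \sum_i r t i.
  move=> t1; have [i ij] : exists i, i != j.
    by case: (eqVneq j o0) => [->|h]; [exists o1|exists o0; rewrite eq_sym].
  rewrite (bigD1 i) //= ltr_pwDl // ?sumr_ge0 // => [|l _]; last exact: r0.
  by rewrite /r (negbTE ij).
exists (mo (r 1)); last by rewrite co_mo /r eqxx subrr mul0r mulr0.
have {1}-> : x = mo (r 0).
  rewrite -[LHS](mo_co x1); congr mo; apply: funext => i.
  by rewrite /r subr0 mul1r if_same.
apply: (@path_component _ _ _ (fun t => mo (r t)) 0 1) => // t /andP[t0 t1].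
  apply: cvg_mo; last by rewrite gt_eqF // s0.
  move=> i; rewrite /r; case: ifP => _; last exact: cvg_cst.
  apply: cvgM; last exact: cvg_cst.
  by apply: cvgB; [exact: cvg_cst|exact: cvg_id].
apply: A_mo; [exact: r0|exact: s0|].
apply: nv_shrink => //; first by move=> i; exact: ltW.
by rewrite subr_ge0 t1 lerBlDr lerDl.
Qed.

Lemma holesP H : holes (Fcurve P) H <->
  exists e x, [/\ forall i, (0 < e i)%N, region e x & H = connected_component A x].
Proof.
split=> [[x [Ax [HE Hbd]]]|[e [x [e0 xe HE]]]].
  have Hx : H x by rewrite HE; exact: connected_component_refl.
  have HA : H `<=` A by rewrite HE; exact: connected_component_sub.
  have nbd y : H y -> forall i, co y i <> 0.
    move=> Hy i yi; have : (closure H `&` bdDelta2 (R := R)) y; last by rewrite Hbd.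
    split; first exact: subset_closure.
    by apply/bdDelta2E; split; [have [] := HA _ Hy|exists i].
  have /AE[xD nx] := Ax; have /Delta2E[x_ge0 x1] := xD.
  have x0 i : 0 < co x i by rewrite lt0r x_ge0 andbT; apply/eqP; exact: nbd.
  exists (ord L (co x)), x; split=> // i; rewrite lt0n; apply/eqP => xi.
  by have [y xy] := component_edge Ax x0 xi; apply: nbd; rewrite HE.
exists x; split; first exact: region_A xe.
(* A boundary point of the closure has component points arbitrarily near, where the j-th order is 0;
   but the order is [e] on the whole component. *)
split=> //; apply/seteqP; split=> // y [cy /bdDelta2E[yD [j yj]]].
have [z [Hz zj]] := cy _ (ord_edge_near yD yj).
rewrite HE in Hz; have [_ _ _ ze] := region_component e0 xe Hz.
by have := e0 j; rewrite -ze zj.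
Qed.

End Curve.
End Triangle.

(** * The polynomials p_d and the existence of all orders *)

Lemma nat_ind3 (P : nat -> Prop) : P 0%N -> P 1%N -> P 2%N ->
  (forall k, P k -> P k.+3) -> forall n, P n.
Proof.
move=> P0 P1 P2 IH n; suff : P n /\ P n.+1 /\ P n.+2 by case.
by elim: n => [|n [? [? ?]]]; split=> //; split=> //; exact: IH.
Qed.

Lemma count_threshold (R : realFieldType) (s : seq R) (m : nat) :
  uniq s -> all (> 0) s -> (m <= size s)%N ->
  exists r : R, [/\ 0 < r, count (< r) s = m & r \notin s].
Proof.
move=> us s0; have ps : path <%R 0 (sort <=%R s).
  rewrite (path_sortedE lt_trans) sort_lt_sorted us andbT.
  by apply/allP => x; rewrite mem_sort => /(allP s0).
rewrite -(size_sort <=%R s) => ms; suff [r [r0 rc rs]] : exists r : R,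
    [/\ 0 < r, count (< r) (sort <=%R s) = m & r \notin sort <=%R s].
  by exists r; rewrite -rc (permP (permEl (perm_sort _ _))) -(mem_sort <=%R).
(* The lower bound 0 is generalised to [lo]: once [x] is to be counted, the recursion must place [r]
   above [x]. *)
elim: (sort <=%R s) {1 2}0 ps m ms => [|x u IH] lo /=.
  by move=> _ [|//] _; exists (lo + 1); rewrite ltrDl ltr01.
move=> /andP[lx pu] [_|m /IH h].
  exists ((lo + x) / 2); have /allP ux := order_path_min lt_trans pu.
  split; first by lra.
    rewrite ltNge (_ : _ <= x); last by lra.
    rewrite add0n; apply/eqP; rewrite -leqn0 leqNgt -has_count; apply/hasPn => y /ux xy.
    by rewrite -leNgt; lra.
  rewrite inE negb_or; apply/andP; split; first by apply/eqP; lra.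
  by apply/negP => /ux; lra.
have [r [r0 rc ru]] := h _ pu; exists r; split; first by lra.
  by rewrite rc r0.
by rewrite inE negb_or ru andbT gt_eqF.
Qed.

Lemma sum_I3n (F : 'I_3 -> nat) : (\sum_i F i = F o0 + F o1 + F o2)%N.
Proof. exact: (sum_I3 F). Qed.

Section Forms.
Variable R : realType.
Local Notation C := R[i].
Implicit Types (t : nat -> nat -> R) (b : nat -> R) (z : 'I_3 -> C).

Definition expo (a b c : nat) : 'I_3 -> nat := fun i => nth 0%N [:: a; b; c] i.

Definition qlist t n : seq (C * ('I_3 -> nat)) :=
  [seq ((qcoef t n i1 i2 (n - i1 - i2))%:C%C, expo i1 i2 (n - i1 - i2)) |
    i1 : 'I_n.+1 <- index_enum 'I_n.+1,
    i2 : 'I_n.+1 <- [seq i2 : 'I_n.+1 <- index_enum 'I_n.+1 | (i1 + i2 <= n)%N]].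

Definition mul_xyz (c : R) (L : seq (C * ('I_3 -> nat))) : seq (C * ('I_3 -> nat)) :=
  [seq (c%:C%C * m.1, fun i => (m.2 i).+1) | m <- L].

Fixpoint plist t b n : seq (C * ('I_3 -> nat)) :=
  match n with
  | k.+3 => qlist t n ++ mul_xyz (b n) (plist t b k)
  | _ => qlist t n
  end.

Lemma ev_cat (L M : seq (C * ('I_3 -> nat))) z : ev (L ++ M) z = ev L z + ev M z.
Proof. by rewrite /ev big_cat. Qed.

Lemma ev_mul_xyz c L z : ev (mul_xyz c L) z = c%:C%C * (z o0 * z o1 * z o2) * ev L z.
Proof.
rewrite /ev big_map mulr_sumr; apply: eq_bigr => m _ /=.
by rewrite !prod_I3 !exprS; ring.
Qed.

Lemma homog_cat n (L M : seq (C * ('I_3 -> nat))) : homog n L -> homog n M -> homog n (L ++ M).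
Proof. by rewrite /homog all_cat => -> ->. Qed.

Lemma homog_mul_xyz n c (L : seq (C * ('I_3 -> nat))) : homog n L -> homog n.+3 (mul_xyz c L).
Proof.
rewrite /homog all_map; apply: sub_all => m /= /eqP <-.
by rewrite !sum_I3n /= !addSn !addnS.
Qed.

Lemma qlistE t n z : qform t n (z o0) (z o1) (z o2) = ev (qlist t n) z.
Proof.
rewrite /ev /qlist big_allpairs_dep /=; apply: eq_bigr => i1 _.
by rewrite big_filter; apply: eq_bigr => i2 _; rewrite prod_I3 /expo /= !mulrA.
Qed.

Lemma homog_qlist t n : homog n (qlist t n).
Proof.
apply/allP => m /allpairsPdep[i1 [i2 [_ + ->]]] /=; rewrite mem_filter => /andP[i12 _].
by apply/eqP; rewrite sum_I3n /expo /= -subnDA subnKC.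
Qed.

Lemma plistE t b n z : pform t b n (z o0) (z o1) (z o2) = ev (plist t b n) z.
Proof.
move: n; apply: nat_ind3 => [|||k IH]; try exact: qlistE.
by rewrite /= ev_cat ev_mul_xyz -IH -qlistE.
Qed.

Lemma homog_plist t b n : homog n (plist t b n).
Proof.
move: n; apply: nat_ind3 => [|||k IH]; rewrite ?homog_qlist //.
by apply: homog_cat; [exact: homog_qlist|exact: homog_mul_xyz].
Qed.

Lemma size_prod_linear (u : nat -> R) n : (size (\prod_(i < n) (u i *: 'X + 1))%R <= n.+1)%N.
Proof.
elim: n => [|n IH]; first by rewrite big_ord0 size_poly1.
rewrite big_ord_recr; apply: leq_trans (size_polyMleq _ _) _.
have h : (size (u n *: 'X + 1 : {poly R})%R <= 2)%N.
  apply: leq_trans (size_polyD _ _) _; rewrite size_poly1 geq_max andbT.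
  by apply: leq_trans (size_scale_leq _ _) _; rewrite size_polyX.
by have := leq_add IH h; rewrite addn2; case: (_ + _)%N.
Qed.

Lemma lead_prod_linear (u : nat -> R) n :
  (\prod_(i < n) (u i *: 'X + 1))`_n = \prod_(i < n) u i.
Proof.
elim: n => [|m IH]; first by rewrite !big_ord0 coef1.
rewrite !big_ord_recr /= mulrDr mulr1 coefD -scalerAr coefZ coefMX /= IH mulrC.
by rewrite [X in _ + X]nth_default ?addr0 // size_prod_linear.
Qed.

Lemma prod_linear_expand (u : nat -> R) n (x y : C) :
  \prod_(i < n) (x + (u i)%:C%C * y) =
  \sum_(k < n.+1) ((\prod_(i < n) (u i *: 'X + 1))`_k)%:C%C * x ^+ (n - k) * y ^+ k.
Proof.
elim: n => [|n IH]; first by rewrite big_ord1 !big_ord0 coef1 !expr0 !mulr1.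
rewrite big_ord_recr /= IH; set B := \prod_(i < n) _.
have Bn : B`_n.+1 = 0 by rewrite nth_default // size_prod_linear.
have E k : (\prod_(i < n.+1) (u i *: 'X + 1))`_k = B`_k + u n * (if k == 0 then 0 else B`_k.-1).
  by rewrite big_ord_recr /= -/B mulrDr mulr1 coefD -scalerAr coefZ coefMX addrC.
transitivity (\sum_(k < n.+2) (B`_k)%:C%C * x ^+ (n.+1 - k) * y ^+ k +
  \sum_(k < n.+2) (u n * (if k == 0 :> nat then 0 else B`_k.-1))%:C%C * x ^+ (n.+1 - k) * y ^+ k).
  rewrite [X in _ = X + _]big_ord_recr /= Bn !mul0r addr0 [X in _ = _ + X]big_ord_recl /= mulr0 !mul0r add0r.
  rewrite mulrDr; congr (_ + _); rewrite mulr_suml; apply: eq_bigr => k _.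
    by rewrite subSn ?leq_ord // exprS; ring.
  by rewrite /bump /= add1n subSS rmorphM exprS; ring.
rewrite -big_split /=.
by apply: eq_bigr => k _; rewrite E rmorphD; ring.
Qed.

(** The boundary coefficients are cyclically symmetric, so the cyclic successor treats the three
    edges by one formula. *)
Definition succ3 (j : 'I_3) : 'I_3 := nth o0 [:: o1; o2; o0] j.

Lemma sum_succ3 (V : nmodType) (F : 'I_3 -> V) j : \sum_i F i = F j + F (succ3 j) + F (succ3 (succ3 j)).
Proof.
by rewrite sum_I3; move: j; apply: I3_ind; rewrite /succ3 //= addrC ?addrA // addrC addrA.
Qed.

Lemma succ3P (P : 'I_3 -> Prop) j : P j -> P (succ3 j) -> P (succ3 (succ3 j)) -> forall i, P i.
Proof. by move: j; apply: I3_ind => *; apply: I3_ind. Qed.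

Section Palindromic.
Variables (t : nat -> nat -> R) (n : nat).
Hypothesis tpos : forall i, (1 <= i <= n)%N -> 0 < t n i.
Hypothesis tinv : forall i, (1 <= i <= n)%N -> t n (n - i).+1 = (t n i)^-1.

(** Reversing the index turns the product into its own inverse, and it is positive. It yields
    [qbetan], needed for the corner coefficients. *)
Lemma prod_t : \prod_(i < n) t n i.+1 = 1.
Proof.
set p := \prod_(i < n) _; have p0 : 0 < p by apply: prodr_gt0 => i _; apply: tpos; exact: ltn_ord.
have : p = p^-1.
  rewrite {1}/p (reindex_inj rev_ord_inj) -prodfV; apply: eq_bigr => i _ /=.
  by rewrite -tinv ?ltn_ord // subnSK.
move=> pE; apply/eqP; rewrite -(@pexpr_eq1 _ p 2) ?ltW //.
by rewrite expr2 {2}pE mulfV // gt_eqF.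
Qed.

Lemma qbeta0 : qbeta t n 0 = 1.
Proof.
rewrite /qbeta -horner_coef0 horner_prod big1 // => i _.
by rewrite hornerD hornerZ hornerX hornerC mulr0 add0r.
Qed.

Lemma qbetan : qbeta t n n = 1.
Proof.
by rewrite -prod_t /qbeta (lead_prod_linear (fun i => t n i.+1)).
Qed.

Lemma qform_edge z j : z j = 0 ->
  ev (qlist t n) z = \prod_(i < n) (z (succ3 j) + (t n i.+1)%:C%C * z (succ3 (succ3 j))).
Proof.
rewrite -qlistE (prod_linear_expand (fun i => t n i.+1)) -/(qbeta t n) /qform.
have qb (k : nat) : (\prod_(i < n) (t n i.+1 *: 'X + 1))`_k = qbeta t n k by [].
move: j; apply: I3_ind; rewrite /succ3 /= => z0; rewrite z0.
- rewrite big_ord_recl /= [X in _ + X]big1 ?addr0; last first.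
    by move=> i _; apply: big1 => k _; rewrite /= exprS !mul0r mulr0 !mul0r.
  rewrite (reindex_inj rev_ord_inj) /=.
  apply: eq_big => [k|k _]; first by rewrite add0n subSS leq_subr.
  rewrite subSS subn0 expr0 mulr1 subKn ?leq_ord // qb /qcoef.
  (* At the corner [k = 0], [qcoef] returns [qbeta t n n] while the expansion asks for
     [qbeta t n 0]; both equal 1. *)
  by case: eqP => [->|_] //=; rewrite subn0 qbeta0 qbetan.
- transitivity (\sum_(i1 < n.+1) (qcoef t n i1 0 (n - i1))%:C%C * z o0 ^+ i1 * z o2 ^+ (n - i1)).
    apply: eq_bigr => i1 _; rewrite big_mkcond big_ord_recl /= addn0 -ltnS ltn_ord big1 ?addr0.
      by rewrite subn0 expr0 mulr1.
    by move=> k _; case: ifP => // _; rewrite /= exprS mul0r mulr0 mul0r.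
  apply: eq_bigr => k _; rewrite qb -!mulrA [_ ^+ _ * _ ^+ _]mulrC; congr (_%:C%C * _).
  rewrite /qcoef eqn0Ngt subn_gt0; case: ltnP => [kn|nk] /=.
    by case: eqP => [->|//]; rewrite subn0 qbeta0 qbetan.
  have -> : (k : nat) = n by apply/eqP; rewrite eqn_leq nk -ltnS ltn_ord.
  by rewrite qbeta0 qbetan.
- transitivity (\sum_(i1 < n.+1) (qcoef t n i1 (n - i1) 0)%:C%C * z o0 ^+ i1 * z o1 ^+ (n - i1)).
    apply: eq_bigr => i1 _; rewrite (bigD1 (rev_ord i1)) /=; last first.
      by rewrite subSS subnKC // -ltnS.
    rewrite subSS subnn expr0 mulr1 big1 ?addr0 // => k /andP[ik /eqP kn].
    rewrite expr0n; case: eqP => [h|_]; last by rewrite mulr0.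
    exfalso; apply: kn; apply: val_inj => /=; rewrite subSS; apply/eqP.
    by rewrite eqn_leq leq_subRL ?leq_ord // ik -subn_eq0 h.
  rewrite (reindex_inj rev_ord_inj) /=; apply: eq_bigr => k _.
  by rewrite subSS subKn ?leq_ord // qb /qcoef.
Qed.

Lemma plist_edge b z j : z j = 0 ->
  ev (plist t b n) z = \prod_(i < n) (z (succ3 j) + (t n i.+1)%:C%C * z (succ3 (succ3 j))).
Proof.
move=> zj; rewrite -(qform_edge zj).
case: n => [//|[//|[//|k]]] /=; rewrite ev_cat ev_mul_xyz.
suff -> : z o0 * z o1 * z o2 = 0 by rewrite mulr0 mul0r addr0.
by move: j zj; apply: I3_ind => ->; rewrite ?mulr0 ?mul0r.
Qed.

Lemma plist_edge_pos b (r : 'I_3 -> R) : (forall i, 0 <= r i) -> (exists j, r j = 0) ->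
  (exists j, r j != 0) -> ev (plist t b n) (vec r) != 0.
Proof.
move=> r0 [j rj] [l rl]; rewrite (plist_edge _ (j := j)); last by rewrite /vec rj sqrtr0.
apply/prodf_neq0 => i _; rewrite /vec -rmorphM -rmorphD -(rmorph0 (real_complex R)).
rewrite (inj_eq (@complexI R)).
have ti : 0 < t n i.+1 by apply: tpos; exact: ltn_ord.
have s0 x : 0 <= Num.sqrt x :> R by exact: sqrtr_ge0.
rewrite paddr_eq0 ?mulr_ge0 ?(ltW ti) // mulf_eq0 (gt_eqF ti) /= !sqrtr_eq0.
apply/negP => /andP[h1 h2]; move: rl; have : forall i, r i <= 0; last first.
  by move=> /(_ l) h; rewrite eq_le h r0.
by apply: (succ3P (j := j)); rewrite // rj.
Qed.

End Palindromic.
End Forms.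

Lemma eq_poly_horner (F : numDomainType) (p q : {poly F}) : (forall w, p.[w] = q.[w]) -> p = q.
Proof.
move=> pq; apply/eqP; rewrite -subr_eq0; apply/negPn/negP => pq0.
have /= := @max_poly_roots _ _ [seq k%:R | k <- iota 0 (size (p - q))] pq0.
rewrite size_map size_iota ltnn => h; suff : false by [].
apply: h; first by apply/allP => w _; rewrite rootE !hornerE pq subrr.
by rewrite map_inj_uniq ?iota_uniq // => a c /eqP; rewrite eqr_nat => /eqP.
Qed.

(** * Existence of points of every order *)

Section Realization.
Variable R : realType.
Local Notation C := R[i].
Implicit Types (t : nat -> nat -> R) (b : nat -> R) (e : 'I_3 -> nat).

Definition realized (M : seq (C * ('I_3 -> nat))) e : Prop :=
  exists r : 'I_3 -> R, [/\ forall i, 0 < r i, nv M r & ord M r = e].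

Lemma sum_succ3n (F : 'I_3 -> nat) j : (\sum_i F i = F j + F (succ3 j) + F (succ3 (succ3 j)))%N.
Proof. exact: (sum_succ3 F). Qed.

Lemma succ3_neq j : (succ3 j == j = false) * (succ3 (succ3 j) == j = false) *
  (j == succ3 j = false) * (j == succ3 (succ3 j) = false) * (succ3 (succ3 j) == succ3 j = false) *
  (succ3 j == succ3 (succ3 j) = false).
Proof. by move: j; apply: I3_ind. Qed.

Lemma upoly_mul_xyz c (M : seq (C * ('I_3 -> nat))) (z : 'I_3 -> C) i :
  upoly (single i) z (mul_xyz c M) = (c%:C%C * (z o0 * z o1 * z o2)) *: ('X * upoly (single i) z M).
Proof.
apply: eq_poly_horner => w; rewrite hornerZ hornerM hornerX !upolyE ev_mul_xyz.
have -> : z o0 * w ^+ single i o0 * (z o1 * w ^+ single i o1) * (z o2 * w ^+ single i o2) =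
   z o0 * z o1 * z o2 * w.
  by move: i; apply: I3_ind; rewrite /single /= ?expr0 ?expr1; ring.
by rewrite !mulrA.
Qed.

(** The point is first taken on the edge, where the order is read off the linear factors: its j-th
    coordinate is 0, the next counts roots, and the last is forced by the sum. Constancy of the
    order along a short path then moves it into the interior. *)
Lemma realized_edge t b n e j :
  (forall i, (1 <= i <= n)%N -> 0 < t n i) ->
  (forall i, (1 <= i <= n)%N -> t n (n - i).+1 = (t n i)^-1) ->
  (forall i k, (1 <= i <= n)%N -> (1 <= k <= n)%N -> t n i = t n k -> i = k) ->
  (\sum_i e i = n)%N -> e j = 0%N -> realized (plist t b n) e.
Proof.
move=> tpos tinv tinj en ej; set L := plist t b n; have Ln : homog n L := homog_plist t b n.
pose s := [seq t n i.+1 | i <- iota 0 n].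
have us : uniq s.
  rewrite map_inj_in_uniq ?iota_uniq // => a c; rewrite !mem_iota !add0n => an cn h.
  by have [] := tinj a.+1 c.+1 an cn h.
have s0 : all (> 0) s by apply/allP => x /mapP[i + ->]; rewrite mem_iota => h; exact: tpos.
have ss : (e (succ3 j) <= size s)%N by rewrite size_map size_iota -en (sum_succ3n e j) ej leq_addr.
(* On the edge, the factors [x w + t_i] have roots [- t_i / x], which lie in the unit disc exactly
   when [t_i < x]; [x] must avoid the [t_i] for the fibre to miss the curve. *)
have [x [x0 xc xs]] := count_threshold us s0 ss.
have tx i : (i < n)%N -> t n i.+1 != x.
  by move=> h; apply: contraNneq xs => <-; apply/mapP; exists i; rewrite ?mem_iota.
pose r (d : R) i := if i == j then d else if i == succ3 j then x ^+ 2 else 1.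
have r_ge0 d : 0 <= d -> forall i, 0 <= r d i.
  by move=> d0 i; rewrite /r; case: ifP => _ //; case: ifP => _; rewrite ?sqr_ge0.
have nv0 : nv L (r 0).
  move=> z zr; have zj : z j = 0.
    by apply/eqP; rewrite -sqnorm_eq0 zr /r eqxx.
  rewrite (plist_edge tpos tinv b zj); apply/prodf_neq0 => i _.
  have ti : 0 < t n i.+1 by apply: tpos; exact: ltn_ord.
  rewrite addr_eq0; apply/negP => /eqP h; have := zr (succ3 j); rewrite h.
  rewrite sqnormN sqnormM sqnorm_real zr /r !succ3_neq eqxx mulr1.
  move=> /eqP; rewrite eqrXn2 ?ltW // => /eqP h'; have := tx i (ltn_ord i).
  by rewrite h' eqxx.
have [d d0 hd] : exists2 d : R, 0 < d & forall y, 0 <= y <= d -> nv L (r y).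
  have co0 : co (tri (r 0)) = r 0 by apply: funext => i; rewrite co_tri.
  have h : nv L (co (tri (r 0))) by rewrite co0.
  have /nbhs_ballP[d /= d0 hd] := nv_near h (fun i => ltac:(by rewrite co0; apply: r_ge0)).
  exists (d / 2); first by rewrite divr_gt0.
  move=> y /andP[y0 yd]; have := hd (tri (r y)).
  have -> : co (tri (r y)) = r y by apply: funext => i; rewrite co_tri.
  apply; apply/ball_co => i; rewrite !co_tri /r; case: ifP => _; last by rewrite subrr normr0.
  by rewrite sub0r normrN ger0_norm //; lra.
exists (r d); split; last 1 first.
- have -> : ord L (r d) = ord L (r 0).
    have -> : r d = r (1 * d) by rewrite mul1r.
    have -> : r 0 = r (0 * d) by rewrite mul0r.
    symmetry; apply: (@ord_path _ _ L (fun y => r (y * d))) => y /andP[y0 y1].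
    + move=> i; rewrite /r; case: (i == j); last exact: cvg_cst.
      by apply: cvgM; [exact: cvg_id|exact: cvg_cst].
    + by apply: r_ge0; rewrite mulr_ge0 // ltW.
    + apply: hd; apply/andP; split; first by rewrite mulr_ge0 // ltW.
      by rewrite ler_piMl // ltW.
  have rs := sqnorm_vec (r_ge0 0 (lexx 0)).
  have vj : vec (r 0) j = 0 by rewrite /vec /r eqxx sqrtr0.
  have oj : ord L (r 0) j = 0%N.
    apply: eq0_cnt; first exact: upoly_neq0 nv0 rs.
    move=> w _; rewrite upolyE.
    have -> : (fun i => vec (r 0) i * w ^+ single j i) = vec (r 0).
      apply: funext => i; rewrite /single; case: eqP => [->|_]; rewrite ?vj ?mul0r //.
      by rewrite expr0 mulr1.
    exact: nv0.
  have oa : ord L (r 0) (succ3 j) = e (succ3 j).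
    rewrite /ord; have -> : upoly (single (succ3 j)) (vec (r 0)) L =
        (x%:C%C ^+ n) *: \prod_(a <- [seq - (y / x)%:C%C | y <- s]) ('X - a%:P).
      apply: eq_poly_horner => w; rewrite upolyE (plist_edge tpos tinv b (j := j)); last first.
        by rewrite vj mul0r.
      rewrite /single !succ3_neq eqxx expr1 expr0 mulr1 /vec /r !succ3_neq eqxx.
      have iE : iota 0 n = index_iota 0 n by rewrite /index_iota subn0.
      have xn : x%:C%C ^+ n = \prod_(i < n) x%:C%C :> C by rewrite prodr_const card_ord.
      rewrite sqrtr_sqr (gtr0_norm x0) sqrtr1 hornerZ horner_prod /s !big_map iE big_mkord.
      rewrite xn -big_split /=; apply: eq_bigr => i _.
      rewrite hornerXsubC opprK mulrDr -!rmorphM mulr1; congr (_ + _).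
      by congr (_%:C%C); rewrite mulrCA mulfV ?mulr1 // gt_eqF.
    rewrite cnt_prod; last by rewrite expf_neq0 // -sqnorm_eq0 sqnorm_real expf_neq0 // gt_eqF.
    rewrite -xc count_map; apply: eq_in_count => y ys /=.
    have y0 : 0 < y := allP s0 _ ys.
    rewrite normr_lt1 sqnormN sqnorm_real expr_lt1 //; last by rewrite divr_ge0 ?ltW.
    by rewrite ltr_pdivrMr // mul1r.
  have := sum_ord Ln nv0 (r_ge0 0 (lexx 0)); rewrite (sum_succ3n _ j) oj oa -en (sum_succ3n _ j) ej.
  move=> /addnI ob; apply: funext; apply: (succ3P (j := j)) => //; first by rewrite oj ej.
- by move=> i; rewrite /r; case: ifP => _ //; case: ifP => _; rewrite ?exprn_gt0.
- by apply: hd; rewrite lexx ltW.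
Qed.

(** The same [r] serves. For [c] large, the homotopy [y q + c z1 z2 z3 M] has no zero on the torus
    for [y] in [[0, 1]]; at [y = 0] the monomial adds one root at 0 in each coordinate. *)
Lemma realized_mul_xyz (q M : seq (C * ('I_3 -> nat))) e : realized M e ->
  exists2 B : R, 0 < B & forall c, B < c -> realized (q ++ mul_xyz c M) (fun i => (e i).+1).
Proof.
move=> [r [r0 nr re]]; have r_ge0 i : 0 <= r i by exact: ltW.
pose T := prod_topology (fun _ : 'I_3 => R : topologicalType).
pose z (u : T) (i : 'I_3) : C := (Num.sqrt (r i))%:C%C * cis (u i).
have zr u i : sqnorm (z u i) = r i by rewrite sqnormM sqnorm_cis mulr1 sqnorm_real sqr_sqrtr.
have zn0 v : (forall i, sqnorm (v i) = r i) -> v o0 * v o1 * v o2 != 0.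
  by move=> vr; rewrite -sqnorm_eq0 !sqnormM !vr !mulf_neq0 // gt_eqF.
(* The homotopy divided by [c], with [y / c] as parameter: large [c] becomes a neighbourhood of 0,
   as the tube lemma requires. *)
pose g (u : T) (y : R) : C := y%:C%C * ev q (z u) + z u o0 * z u o1 * z u o2 * ev M (z u).
have H (u : T) : [set u : T | forall i, `[- pi, pi : R]%classic (u i)] u ->
    g u 0 != 0 /\ ctends (filter_prod (nbhs u) (nbhs (0 : R))) (fun p => g p.1 p.2) (g u 0).
  move=> _; split; first by rewrite /g mul0r add0r mulf_neq0 ?zn0 ?nr.
  have FF : Filter (filter_prod (nbhs u) (nbhs (0 : R))).
    by apply: filter_prod_filter; exact: nbhs_filter.
  have c i : (fun p : T * R => p.1 i) @ filter_prod (nbhs u) (nbhs (0 : R)) --> u i.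
    have c : (fun v : T => v i) @ nbhs u --> u i.
      exact: (@proj_continuous _ (fun _ : 'I_3 => R : topologicalType) i u).
    exact: (cvg_comp fst (fun v : T => v i) cvg_fst c).
  have cz i : ctends (filter_prod (nbhs u) (nbhs (0 : R))) (fun p => z p.1 i) (z u i).
    apply: (@ctendsM _ _ _ FF (fun _ => (Num.sqrt (r i))%:C%C) (fun p => cis (p.1 i))).
      exact: ctends_cst.
    exact: (@ctends_cis _ _ _ FF (fun p => p.1 i)).
  have cq L : ctends (filter_prod (nbhs u) (nbhs (0 : R))) (fun p => ev L (z p.1)) (ev L (z u)).
    exact: (@ctends_ev _ _ _ _ FF L (fun p => z p.1)).
  apply: (@ctendsD _ _ _ FF (fun p => p.2%:C%C * ev q (z p.1))
    (fun p => z p.1 o0 * z p.1 o1 * z p.1 o2 * ev M (z p.1))).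
    apply: (@ctendsM _ _ _ FF (fun p => p.2%:C%C) (fun p => ev q (z p.1))) => //.
    by apply: (@ctends_real _ _ _ FF (fun p => p.2)); exact: cvg_snd.
  apply: (@ctendsM _ _ _ FF (fun p => z p.1 o0 * z p.1 o1 * z p.1 o2) (fun p => ev M (z p.1))) => //.
  apply: (@ctendsM _ _ _ FF (fun p => z p.1 o0 * z p.1 o1) (fun p => z p.1 o2)) => //.
  exact: (@ctendsM _ _ _ FF (fun p => z p.1 o0) (fun p => z p.1 o1)).
have := near_compact_neq0 (f := g) (@compact_torus R 'I_3) H.
move=> /(_ (nbhs_filter (0 : R))) /nbhs_ballP[d /= d0 hd].
exists d^-1; first by rewrite invr_gt0.
move=> c dc; have c0 : 0 < c by apply: lt_trans dc; rewrite invr_gt0.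
have key (y : R) v : 0 <= y <= 1 -> (forall i, sqnorm (v i) = r i) ->
    y%:C%C * ev q v + ev (mul_xyz c M) v != 0.
  move=> /andP[y0 y1] vr.
  have /choice[u up] : forall i, exists u : R, - pi <= u <= pi /\ v i = (Num.sqrt (r i))%:C%C * cis u.
    by move=> i; have [u up E] := polar (v i); exists u; rewrite -vr.
  have -> : v = z u by apply: funext => i; have [] := up i.
  have yc : ball (0 : R) d (y / c).
    rewrite /ball /= sub0r normrN ger0_norm ?divr_ge0 ?(ltW c0) //.
    rewrite ltr_pdivrMr //; apply: (le_lt_trans y1); move: dc.
    by rewrite -[d^-1]mul1r ltr_pdivrMr // mulrC.
  have := hd _ yc u; rewrite ev_mul_xyz => h.
  have -> : y%:C%C * ev q (z u) + c%:C%C * (z u o0 * z u o1 * z u o2) * ev M (z u) =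
    c%:C%C * g u (y / c).
    rewrite /g mulrDr !(mulrA c%:C%C); congr (_ * _ + _).
    by rewrite -rmorphM mulrCA mulfV ?mulr1 // gt_eqF.
  rewrite mulf_neq0 //; first by rewrite -sqnorm_eq0 sqnorm_real expf_neq0 // gt_eqF.
  by apply: h => i /=; have [ui _] := up i; rewrite in_itv.
have nqM : nv (q ++ mul_xyz c M) r.
  by move=> v vr; rewrite ev_cat -[ev q v]mul1r; apply: (key 1) => //; rewrite ler01 lexx.
exists r; split=> //; apply: funext => i.
have zv := sqnorm_vec r_ge0.
pose U := upoly (single i) (vec r).
have [m1 hm1] := size_upoly (R := R) (single i) q; have [m2 hm2] := size_upoly (R := R) (single i) (mul_xyz c M).
have h := @cnt_homotopy R (fun y => y%:C%C *: U q + U (mul_xyz c M)) (maxn m1 m2).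
have -> : ord (q ++ mul_xyz c M) r i = cnt (1%:C%C *: U q + U (mul_xyz c M)).
  by rewrite scale1r /U /ord /upoly big_cat.
rewrite -h; last 3 first.
- move=> y; apply: leq_trans (size_polyD _ _) _; rewrite geq_max !leq_max hm2 orbT andbT.
  by rewrite (leq_trans (size_scale_leq _ _) (hm1 _)).
- move=> y _ k; rewrite coefD coefZ; under eq_fun do rewrite coefD coefZ.
  apply: ctendsD; last exact: ctends_cst.
  by apply: ctendsM; [apply: ctends_real; exact: cvg_id|exact: ctends_cst].
- move=> y y01 w w1; rewrite hornerD hornerZ !upolyE; apply: key => // l.
  by rewrite sqnormM sqnormX w1 expr1n mulr1.
have M0 : upoly (single i) (vec r) M != 0 by exact: upoly_neq0 nr zv.
have cz : c%:C%C * (vec r o0 * vec r o1 * vec r o2) != 0.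
  by rewrite mulf_neq0 ?(zn0 _ zv) // -sqnorm_eq0 sqnorm_real expf_neq0 // gt_eqF.
rewrite scale0r add0r /U upoly_mul_xyz cntZ //; last by rewrite mulf_neq0 ?polyX_eq0.
rewrite cntM ?polyX_eq0 // -/(ord M r i) re.
by have := @cntZXn C 1 1 (oner_neq0 _); rewrite scale1r expr1 => ->.
Qed.

(** Orders of sum [k] have entries at most [k], hence form a finite type; the sum of their positive
    thresholds exceeds each one, with 1 as default for orders that do not occur. *)
Lemma realized_threshold k (q M : seq (C * ('I_3 -> nat))) : exists2 B : R, 0 < B &
  forall e, (\sum_i e i = k)%N -> realized M e ->
    forall c, B < c -> realized (q ++ mul_xyz c M) (fun i => (e i).+1).
Proof.
have /choice[B hB] : forall e : {ffun 'I_3 -> 'I_k.+1}, exists B : R, 0 < B /\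
    (realized M (fun i => e i : nat) ->
      forall c, B < c -> realized (q ++ mul_xyz c M) (fun i => (e i : nat).+1)).
  move=> e; have [/(realized_mul_xyz q)[B B0 hB]|h] := pselect (realized M (fun i => e i : nat)).
    by exists B.
  by exists 1; split; [exact: ltr01|move=> /h].
exists (1 + \sum_e B e).
  by rewrite ltr_pwDl // sumr_ge0 // => e _; have [/ltW] := hB e.
move=> e ek re c Bc; pose f : {ffun 'I_3 -> 'I_k.+1} := [ffun i => inord (e i)].
have fe : e = (fun i => f i : nat).
  apply: funext => i; rewrite ffunE inordK // ltnS -ek (bigD1 i) //=; exact: leq_addr.
have [_ h] := hB f; rewrite fe; apply: h; first by rewrite -fe.
apply: le_lt_trans Bc; rewrite (bigD1 f) //= addrCA lerDl addr_ge0 // sumr_ge0 // => g _.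
by have [/ltW] := hB g.
Qed.

End Realization.

(** * Counting edge points and holes *)

Section Count.
Variable R : realType.
Local Notation C := R[i].
Local Notation pt := (R * R * R)%type.

Lemma mo_scale (c : R) (r : 'I_3 -> R) : c != 0 -> mo (fun i => c * r i) = mo r.
Proof.
move=> c0; congr tri; apply: funext => i.
by rewrite -mulr_sumr invfM mulrACA mulfV // mul1r.
Qed.

Lemma edge_card (t : nat -> nat -> R) (b : nat -> R) (n : nat) (j : 'I_3) :
  (forall i, (1 <= i <= n)%N -> 0 < t n i) ->
  (forall i, (1 <= i <= n)%N -> t n (n - i).+1 = (t n i)^-1) ->
  (forall i k, (1 <= i <= n)%N -> (1 <= k <= n)%N -> t n i = t n k -> i = k) ->
  (Fcurve (pform t b n) `&` [set x | Delta2 x /\ co x j = 0]) #= `I_n.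
Proof.
move=> tpos tinv tinj.
(* Squared moduli of the zero of a linear factor on the edge, with last coordinate 1; positivity of
   the [t] makes them determine the factor. *)
pose r (i : nat) l := if l == j then 0 else if l == succ3 j then (t n i.+1) ^+ 2 else 1 : R.
have sumr i : \sum_l r i l = (t n i.+1) ^+ 2 + 1.
  by rewrite (sum_succ3 _ j) /r !succ3_neq !eqxx add0r.
have sumr0 i : 0 < \sum_l r i l by rewrite sumr ltr_wpDl ?sqr_ge0.
suff -> : Fcurve (pform t b n) `&` [set x | Delta2 x /\ co x j = 0] = (fun i => mo (r i)) @` `I_n.
  apply: inj_card_eq => i k; rewrite !inE /= => iN kN ik.
  have E l : (\sum_l r i l)^-1 * r i l = (\sum_l r k l)^-1 * r k l.
    by have := congr1 (fun x => co x l) ik; rewrite !co_mo.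
  have rb m : r m (succ3 (succ3 j)) = 1 by rewrite /r !succ3_neq.
  have ra m : r m (succ3 j) = t n m.+1 ^+ 2 by rewrite /r !succ3_neq eqxx.
  have := E (succ3 (succ3 j)); have := E (succ3 j); rewrite !rb !ra !mulr1 => + h1.
  rewrite h1 => /mulfI; rewrite invr_eq0 gt_eqF // => /(_ isT)/eqP.
  have [ti tk] : 0 < t n i.+1 /\ 0 < t n k.+1 by split; apply: tpos.
  by rewrite eqrXn2 ?ltW // => /eqP h; have [] := tinj i.+1 k.+1 iN kN h.
apply/seteqP; split=> x.
  move=> [[z1 [z2 [z3 [zn0 [Pz xz]]]]] [xD xj]].
  pose z := (fun i : 'I_3 => [:: z1; z2; z3]`_i).
  have Lz : ev (plist t b n) z = 0 by rewrite -plistE.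
  have s0 : \sum_i sqnorm (z i) != 0.
    move: xD; rewrite xz moE -/z => /Delta2E[_]; rewrite co_mo -mulr_sumr => h.
    by apply/eqP => s0; move: h; rewrite s0 mulr0 => /esym/eqP; rewrite oner_eq0.
  have zj : z j = 0.
    move/eqP: xj; rewrite xz moE -/z co_mo mulf_eq0 invr_eq0 (negbTE s0) /= sqnorm_eq0.
    by move/eqP.
  move/eqP: Lz; rewrite (plist_edge tpos tinv b zj) => /prodf_eq0[i _].
  rewrite addr_eq0 => /eqP za; exists i; first exact: ltn_ord.
  have zb : sqnorm (z (succ3 (succ3 j))) != 0.
    apply: contra s0 => zb; rewrite (sum_succ3 _ j) zj za.
    move: zb; rewrite sqnorm_eq0 => /eqP ->.
    by rewrite mulr0 oppr0 sqnorm0 !addr0.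
  rewrite xz moE -/z -(mo_scale _ zb); congr mo; apply: funext.
  apply: (succ3P (j := j)); rewrite /r !succ3_neq ?eqxx ?mulr1 ?mulr0 //.
    by rewrite -/(z j) zj sqnorm0.
  rewrite -/(z (succ3 j)) za sqnormN sqnormM sqnorm_real mulrC //.
move=> [i /= iN <-].
have r0 i' l : 0 <= r i' l by rewrite /r; case: ifP => // _; case: ifP => // _; rewrite sqr_ge0.
split; last first.
  split; first by apply: Delta2_mo.
  by rewrite co_mo /r eqxx mulr0.
pose z (l : 'I_3) : C := if l == j then 0 else if l == succ3 j then - (t n i.+1)%:C%C else 1.
have zr l : sqnorm (z l) = r i l.
  rewrite /z /r; case: ifP => _; rewrite ?sqnorm0 //; case: ifP => _; rewrite ?sqnorm1 //.
  by rewrite sqnormN sqnorm_real.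
exists (z o0), (z o1), (z o2); split; [|split].
- apply/negP => /eqP[h0 h1 h2]; have := sumr0 i.
  by rewrite sum_I3 -!zr h0 h1 h2 sqnorm0 !addr0 ltxx.
- rewrite plistE (plist_edge tpos tinv b (j := j)); last by rewrite /z eqxx.
  rewrite (bigD1 (Ordinal iN)) //= /z !succ3_neq eqxx mulr1 addNr mul0r //.
- rewrite moE; congr mo; apply: funext => l; rewrite -zr.
  by move: l; apply: I3_ind.
Qed.

Definition interior_pairs n : seq (nat * nat) := [seq (i, j) | j <- iota 0 n.-1, i <- iota 0 j].

(* The interior lattice points of the triangle of size n, indexed by pairs i < j < n - 1. *)
Definition interior_point n (p : nat * nat) : 'I_3 -> nat := expo p.1.+1 (p.2 - p.1) (n.-1 - p.2).

Lemma mem_interior_pairs n p : (p \in interior_pairs n) = (p.1 < p.2 < n.-1)%N.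
Proof.
apply/allpairsPdep/idP => [[j [i [+ + ->]]]|/andP[ij jn]].
  by rewrite !mem_iota !add0n /= => -> ->.
by exists p.2, p.1; rewrite !mem_iota !add0n; case: p ij jn.
Qed.

Lemma size_interior_pairs n : size (interior_pairs n) = ((n - 1) * (n - 2) %/ 2)%N.
Proof.
rewrite size_allpairs_dep sumnE big_map.
under eq_bigr => j _ do rewrite size_iota.
have -> : iota 0 n.-1 = index_iota 0 n.-1 by rewrite /index_iota subn0.
by rewrite bin2_sum bin2 divn2 subn1 subn2.
Qed.

Lemma uniq_interior_pairs n : uniq (interior_pairs n).
Proof.
apply: allpairs_uniq_dep; rewrite ?iota_uniq //.
  by move=> j _; exact: iota_uniq.
by move=> [j i] [j' i'] _ _ /= [-> ->].
Qed.

Lemma holes_card (n : nat) (L : seq (C * ('I_3 -> nat))) (P : C -> C -> C -> C) :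
  (forall z1 z2 z3 : C, P z1 z2 z3 = ev L (fun i => [:: z1; z2; z3]`_i)) ->
  homog n L ->
  (forall r, (forall i, 0 <= r i) -> (exists j, r j = 0) -> (exists j, r j != 0) ->
    ev L (vec r) != 0) ->
  (forall e, (\sum_i e i = n)%N -> realized L e) ->
  holes (Fcurve P) #= `I_((n - 1) * (n - 2) %/ 2)%N.
Proof.
move=> PE Ln edge_pos real; set A := Delta2 (R := R) `\` Fcurve P.
have reg e : (\sum_i e i = n)%N -> exists x, region L e x.
  move=> /real[r [r0 nr re]].
  have s0 : 0 < \sum_i r i by rewrite sum_I3 !addr_gt0.
  have c0 : 0 < (\sum_i r i)^-1 by rewrite invr_gt0.
  exists (mo r); split.
  - by apply: Delta2_mo => // i; exact: ltW.
  - by move=> i; rewrite co_mo mulr_gt0.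
  - by rewrite co_mo; exact: (nv_scale Ln).
  - by rewrite co_mo (ord_scale Ln) // => i; exact: ltW.
(* A sample point in each region; different interior orders give different components, since
   [region_component] fixes the order on a whole component. *)
pose pick e : pt := xget 0 (region L e).
have pickP e : (\sum_i e i = n)%N -> region L e (pick e).
  by move=> /reg[x xe]; rewrite /pick; case: xgetP => // /(_ x).
pose s := interior_pairs n; pose lat k := interior_point n (nth (0%N, 0%N) s k).
have lat_s k : (k < size s)%N -> (forall i, (0 < lat k i)%N) /\ (\sum_i lat k i = n)%N.
  move=> /(mem_nth (0%N, 0%N)); rewrite mem_interior_pairs => /andP[h1 h2]; split.
    by apply: I3_ind; rewrite /lat /interior_point /expo //= subn_gt0.
  rewrite sum_I3n /lat /interior_point /expo /=; move: h1 h2.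
  by case: (nth _ s k) => p1 p2 /=; lia.
rewrite -size_interior_pairs -/s.
suff -> : holes (Fcurve P) = (fun k => connected_component A (pick (lat k))) @` `I_(size s).
  apply: inj_card_eq => k k'; rewrite !inE /= => ks ks' E.
  have [k0 kn] := lat_s k ks; have [k0' kn'] := lat_s k' ks'.
  have h : connected_component A (pick (lat k)) (pick (lat k')).
    rewrite E; apply: connected_component_refl.
    exact: (region_A PE Ln (pickP _ kn')).
  have [_ _ _ oe] := region_component PE Ln edge_pos k0 (pickP _ kn) h.
  have [_ _ _ oe'] := pickP _ kn'; move: oe; rewrite oe' => lk.
  apply/eqP; rewrite -(nth_uniq (0%N, 0%N) ks ks' (uniq_interior_pairs n)) -/s.
  have := congr1 (fun f => f o0) lk; have := congr1 (fun f => f o1) lk.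
  move: (mem_nth (0%N, 0%N) ks) (mem_nth (0%N, 0%N) ks').
  rewrite !mem_interior_pairs /lat /interior_point /expo /=.
  case: (nth _ s k) (nth _ s k') => [a c] [a' c'] /= /andP[ac _] /andP[ac' _] h1 [h2].
  rewrite h2 in ac' h1 *; apply/eqP; congr (_, _).
  by rewrite -(subnK (ltnW ac)) -(subnK (ltnW ac')) h1.
apply/seteqP; split=> H.
  move=> /(holesP PE Ln edge_pos)[e [x [e0 xe ->]]].
  have en : (\sum_i e i = n)%N.
    by have [_ x0 nx <-] := xe; apply: (sum_ord Ln nx) => i; exact: ltW.
  pose p := ((e o0).-1, (e o0 + e o1).-1)%N.
  have e00 := e0 o0; have e10 := e0 o1; have e20 := e0 o2.
  move: en; rewrite sum_I3n => en.
  have ps : p \in s.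
    rewrite mem_interior_pairs /p /= -en; apply/andP; split; move: e00 e10 e20; lia.
  exists (index p s); first by rewrite /= index_mem.
  have -> : lat (index p s) = e.
    rewrite /lat nth_index //; apply: funext; rewrite /interior_point /expo /p -en /=.
    by apply: I3_ind => /=; move: e00 e10 e20; lia.
  apply: same_connected_component.
  apply: (region_connected PE Ln _ xe); apply: pickP.
  by rewrite sum_I3n.
move=> [k /= ks <-]; apply/(holesP PE Ln edge_pos); have [k0 kn] := lat_s k ks.
by exists (lat k), (pick (lat k)); split=> //; exact: pickP.
Qed.

Lemma plist_eq (t : nat -> nat -> R) (b b' : nat -> R) n :
  (forall k, (3 <= k <= n)%N -> k = n %[mod 3] -> b k = b' k) -> plist t b n = plist t b' n.
Proof.
move: n; apply: nat_ind3 => // k IH h /=; rewrite h ?leqnn // IH // => l /andP[l3 lk] lm.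
by apply: h; rewrite ?l3 ?(leq_trans lk) ?leqW // lm -addn3 modnDr.
Qed.

(** Choosing the bound as a function of the list [M] makes it depend on [b] only through the
    preceding polynomial. *)
Definition threshold (t : nat -> nat -> R) n (M : seq (C * ('I_3 -> nat))) : R :=
  sval (cid2 (realized_threshold (n - 3) (qlist t n) M)).

Lemma plist_realized (t : nat -> nat -> R) (b : nat -> R) (d n : nat) :
  (forall n i, (n <= d)%N -> n = d %[mod 3] -> (1 <= i <= n)%N -> 0 < t n i) ->
  (forall n i j, (n <= d)%N -> n = d %[mod 3] ->
     (1 <= i <= n)%N -> (1 <= j <= n)%N -> t n i = t n j -> i = j) ->
  (forall n i, (n <= d)%N -> n = d %[mod 3] -> (1 <= i <= n)%N -> t n (n - i).+1 = (t n i)^-1) ->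
  (forall n, (3 <= n <= d)%N -> n = d %[mod 3] -> threshold t n (plist t b (n - 3)) < b n) ->
  (n <= d)%N -> n = d %[mod 3] -> forall e, (\sum_i e i = n)%N -> realized (plist t b n) e.
Proof.
move=> tpos tinj tinv bB nd nm e en.
move: n nd nm e en; apply: nat_ind3; [..|move=> k IH] => nd nm e en.
all: have [[j ej]|e0] := pselect (exists j, e j = 0%N).
all: try by apply: (realized_edge b _ _ _ en ej) => [i|i|i l]; [exact: tpos|exact: tinv|exact: tinj].
all: have {}e0 i : (0 < e i)%N by rewrite lt0n; apply/eqP => ei; apply: e0; exists i.
all: move: en (e0 o0) (e0 o1) (e0 o2); rewrite sum_I3n.
(* Three positive coordinates cannot add up to 0, 1 or 2. *)
- lia.
- lia.
- lia.
move=> en e00 e01 e02; have kd : (k <= d)%N by apply: leq_trans nd; rewrite -addn3 leq_addr.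
have km : k = d %[mod 3] by rewrite -nm -(addn3 k) modnDr.
have -> : e = (fun i => (e i).-1.+1) by apply: funext => i; rewrite prednK.
have := bB k.+3; rewrite nd nm => /(_ isT erefl); rewrite /threshold.
have -> : (k.+3 - 3 = k)%N by rewrite -(addn3 k) addnK.
case: cid2 => B _ hB /= bk; apply: hB => //; last first.
  by apply: IH => //; rewrite sum_I3n; lia.
by rewrite sum_I3n; lia.
Qed.

End Count.

Unset Implicit Arguments. Set Strict Implicit. Set Printing Implicit Defensive.

Theorem theorem2p1 (R : realType) (d : nat) (hd : (1 <= d)%N)
  (t : nat -> nat -> R)
  (tpos : forall n i, (n <= d)%N -> n = d %[mod 3] ->
            (1 <= i <= n)%N -> 0 < t n i)
  (tinj : forall n i j, (n <= d)%N -> n = d %[mod 3] ->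
            (1 <= i <= n)%N -> (1 <= j <= n)%N -> t n i = t n j -> i = j)
  (tinv : forall n i, (n <= d)%N -> n = d %[mod 3] ->
            (1 <= i <= n)%N -> t n (n - i).+1 = (t n i)^-1)
  (tdisj : forall n i j, (3 <= n <= d)%N -> n = d %[mod 3] ->
            (1 <= i <= n)%N -> (1 <= j <= n - 3)%N -> t n i != t (n - 3)%N j) :
  exists B : nat -> (nat -> R) -> R,
    (forall n b, (3 <= n <= d)%N -> n = d %[mod 3] -> 0 < B n b) /\
    (forall n b b', (3 <= n <= d)%N -> n = d %[mod 3] ->
       (forall k, (3 <= k < n)%N -> k = n %[mod 3] -> b k = b' k) ->
       B n b = B n b') /\
    (forall b : nat -> R,
       (forall n, (3 <= n <= d)%N -> n = d %[mod 3] -> B n b < b n) ->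
       holes (Fcurve (pform t b d)) #= `I_(((d - 1) * (d - 2)) %/ 2)%N /\
       (Fcurve (pform t b d) `&` @edge1 R) #= `I_d /\
       (Fcurve (pform t b d) `&` @edge2 R) #= `I_d /\
       (Fcurve (pform t b d) `&` @edge3 R) #= `I_d).
Proof.
exists (fun n b => threshold t n (plist t b (n - 3))); split; [|split].
- by move=> n b _ _; rewrite /threshold; case: cid2.
(* [plist t b (n - 3)] reads [b] only at indices up to [n - 3] in the residue class of [n]. *)
- move=> n b b' /andP[n3 nd] nm bb; congr threshold; apply: plist_eq => k /andP[k3 kn] km.
  apply: bb; first by move: k3 kn n3; lia.
  by rewrite km -[in RHS](subnK n3) modnDr.
move=> b bB.
have tp i : (1 <= i <= d)%N -> 0 < t d i by exact: tpos.
have ti i : (1 <= i <= d)%N -> t d (d - i).+1 = (t d i)^-1 by exact: tinv.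
have tj i k : (1 <= i <= d)%N -> (1 <= k <= d)%N -> t d i = t d k -> i = k by exact: tinj.
split.
  apply: (@holes_card R d (plist t b d)) => //.
  - by move=> z1 z2 z3; rewrite -plistE.
  - exact: homog_plist.
  - exact: plist_edge_pos.
  - by move=> e; exact: (plist_realized tpos tinj tinv bB).
by split; [exact: (edge_card b o0)|split; [exact: (edge_card b o1)|exact: (edge_card b o2)]].
Qed.
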